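(* Let $Q$ be a complete connected Riemannian manifold with distance $d$, let $s\ge2$, $T>0$, let $\mathbb{G}=(\mathcal{V},\mathcal{E})$ be an undirected graph on $\mathcal{V}=\{1,\dots,s\}$, and fix boundary data $q_i^0,q_i^T\in Q$, $v_i^0\in T_{q_i^0}Q$, $v_i^T\in T_{q_i^T}Q$. For each $(i,j)\in\mathcal{E}$ let $0<r_{ij}<r_{ij}^*<R_{ij}$ and $0<V_{ij}^-<V_{ij}^*$ be real numbers, with $r_{ij},r_{ij}^*,R_{ij}$ symmetric in $(i,j)$. Let $V_{ij}:Q\times Q\to\mathbb{R}$ be $C^1$, non-negative, with $V_{ij}=V_{ji}$ and $V_{ij}(p,q)=V_{ij}(q,p)$, such that $V_{ij}>V_{ij}^*$ on $C_{ij}^*$ and $V_{ij}<V_{ij}^-$ on $S_{ij}$. Let $q=(q_1,\dots,q_s)\in\Omega$ be a reference trajectory such that $(q_i(t),q_j(t))\in S_{ij}$ for all $(i,j)\in\mathcal{E}$ and $t\in[0,T]$, and define for $i\in\mathcal{V}$ $$a_i=\sup_{t\in[0,T]}\Big\|\frac{D}{dt}\dot q_i(t)\Big\|,\qquad c=T\sum_{i=1}^s\Big[a_i^2+\sum_{j\in\mathcal{N}_i}V_{ij}^-\Big],\qquad v_i=\sqrt{cT}+\sqrt{cT+\|v_i^0\|^2}.$$ If $$V_{ij}^*>\frac{c(v_i+v_j)}{2(r_{ij}^*-r_{ij})}\quad\text{for all }(i,j)\in\mathcal{E},$$ then every minimizer $q^*=(q_1^*,\dots,q_s^* )\in\Omega$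 of $J$ avoids collision with tolerances $r_{ij}$, i.e. $(q_i^*(t),q_j^*(t))\notin C_{ij}$ for all $(i,j)\in\mathcal{E}$ and $t\in[0,T]$.
   Context: $g$ is the metric of $Q$, $\|\cdot\|$ its norm, and $\frac{D}{dt}$ covariant differentiation along curves (Levi-Civita connection). $\frac{D^2q}{dt^2}=\frac{D}{dt}\dot q$. $\mathcal{E}\subseteq\mathcal{V}\times\mathcal{V}$ is symmetric and $\mathcal{N}_i=\{j:(i,j)\in\mathcal{E}\}$ (other agents, so $i\notin\mathcal{N}_i$). $\Omega=\Omega_1\times\cdots\times\Omega_s$, where $\Omega_i$ is the set of $C^1$ piecewise smooth curves $q_i:[0,T]\to Q$ with $q_i(0)=q_i^0$, $\dot q_i(0)=v_i^0$, $q_i(T)=q_i^T$, $\dot q_i(T)=v_i^T$. The supremum defining $a_i$ is over times where the second derivative exists. $$J(q_1,\dots,q_s)=\frac12\sum_{i=1}^s\int_0^T\Big(\Big\|\frac{D^2q_i}{dt^2}(t)\Big\|^2+\frac12\sum_{j\in\mathcal{N}_i}V_{ij}(q_i(t),q_j(t))\Big)dt.$$ A minimizer of $J$ is $q^*\in\Omega$ with $J(q^* )\le J(\omega)$ for all $\omega\in\Omega$. Regions: $C_{ij}=\{(p,q)\in Q\times Q: d(p,q)<r_{ij}\}$ (collision region), $C_{ij}^*=\{(p,q): d(p,q)<r_{ij}^*\}$ (risk region), $S_{ij}=\{(p,q): d(p,q)>R_{ij}\}$ (safety region). *)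

(* Defs.v *)
From HB Require Import structures.
From mathcomp Require Import all_boot all_order all_algebra.
From mathcomp Require Import all_classical all_reals all_analysis.
Set Implicit Arguments.
Unset Strict Implicit.
Unset Printing Implicit Defensive.
Import Order.TTheory GRing.Theory Num.Theory numFieldNormedType.Exports.
Local Open Scope classical_set_scope.
Local Open Scope ring_scope.

Section Calculus.
Context {R : realType}.

(* [f] is of class C^k on the open set [U]. *)
Fixpoint class_C {V W : normedModType R} (k : nat) (U : set V) (f : V -> W)
    : Prop :=
  if k is k'.+1 then
    (forall x, U x -> differentiable f x) /\
    (forall v : V, class_C k' U (fun x => 'D_v f x))
  else forall x, U x -> {for x, continuous f}.

Definition smooth {V W : normedModType R} (U : set V) (f : V -> W) : Prop :=
  forall k, class_C k U f.

(* Derivative at [t] of a function on [a, b]: two-sided inside the interval,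
   one-sided at the end points; only values of [f] on [a, b] matter. *)
Definition diff_quot {W : normedModType R} (f : R -> W) (t s : R) : W :=
  (s - t)^-1 *: (f s - f t).

Definition derivable_in {W : normedModType R} (a b : R) (f : R -> W) (t : R)
    : Prop :=
  cvg (diff_quot f t @ within `[a, b]%classic t^').

Definition derive_in {W : normedModType R} (a b : R) (f : R -> W) (t : R) : W :=
  lim (diff_quot f t @ within `[a, b]%classic t^').

End Calculus.

Section Manifolds.
Context {R : realType} {n : nat} {M : topologicalType}.

(* A homeomorphism from the open set [dom] onto the open set
   [coord @` dom] of R^n; the values of [coord] outside [dom] and those of
   [param] outside [coord @` dom] are irrelevant. *)
Record chart := Chart {
  dom : set M;
  coord : M -> 'rV[R]_n;
  param : 'rV[R]_n -> M;
  dom_open : open dom;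
  codom_open : open (coord @` dom);
  coordK : forall p, dom p -> param (coord p) = p;
  coord_continuous : forall p, dom p -> {for p, continuous coord};
  param_continuous :
    forall x, (coord @` dom) x -> {for x, continuous param}
}.

Definition codom (al : chart) : set 'rV[R]_n := coord al @` dom al.

Definition transition (al be : chart) : 'rV[R]_n -> 'rV[R]_n :=
  coord be \o param al.

Record manifold := Manifold {
  hausdorff : hausdorff_space M;
  countable_base : @second_countable M;
  atlas : set chart;
  chart_at : M -> chart;
  chart_at_atlas : forall p, atlas (chart_at p);
  chart_at_dom : forall p, dom (chart_at p) p;
  transition_smooth : forall al be, atlas al -> atlas be ->
    smooth (coord al @` (dom al `&` dom be)) (transition al be)
}.

End Manifolds.
Arguments chart : clear implicits.
Arguments manifold : clear implicits.

Section Riemannian.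
Context {R : realType} {n : nat} {M : topologicalType}.

Definition bilin (A : 'M[R]_n) (u v : 'rV[R]_n) : R := (u *m A *m v^T) 0 0.

(* [gmat al x] is the matrix (g_ij) in the chart [al], at the point with
   coordinates [x]; [gmat_compat] says that the matrices given in the various
   charts represent one and the same bilinear form on each tangent space. *)
Record riemannian := Riemannian {
  mfd :> manifold R n M;
  gmat : chart R n M -> 'rV[R]_n -> 'M[R]_n;
  gmat_smooth : forall al, atlas mfd al ->
    forall i j, smooth (codom al) (fun x => (gmat al x i j : R^o));
  gmat_sym : forall al, atlas mfd al ->
    forall x, codom al x -> (gmat al x)^T = gmat al x;
  gmat_pos : forall al, atlas mfd al ->
    forall x, codom al x -> forall v, v != 0 -> 0 < bilin (gmat al x) v v;
  gmat_compat : forall al be, atlas mfd al -> atlas mfd be ->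
    forall p, dom al p -> dom be p -> forall u v : 'rV[R]_n,
      bilin (gmat al (coord al p)) u v =
      bilin (gmat be (coord be p)) ('d (transition al be) (coord al p) u)
                                   ('d (transition al be) (coord al p) v)
}.

Variable Q : riemannian.

(* Components of a tangent vector at [p] in all the charts; only charts of the
   atlas around [p] are relevant. *)
Record tangent (p : M) := Tangent {
  comp :> chart R n M -> 'rV[R]_n;
  comp_compat : forall al be, atlas Q al -> atlas Q be ->
    dom al p -> dom be p ->
    comp be = 'd (transition al be) (coord al p) (comp al)
}.

(* By [gmat_compat], the choice of the chart around [p] is immaterial. *)
Definition gnorm (p : M) (v : chart R n M -> 'rV[R]_n) : R :=
  let al := chart_at Q p in Num.sqrt (bilin (gmat Q al (coord al p)) (v al) (v al)).

(* Partial derivative in the i-th coordinate, and the Christoffel symbols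
   Gamma^k_ij of the Levi-Civita connection. *)
Definition partial (i : 'I_n) (h : 'rV[R]_n -> R^o) (x : 'rV[R]_n) : R :=
  'D_(delta_mx 0 i) h x.

Definition christoffel (al : chart R n M) (x : 'rV[R]_n) (k i j : 'I_n) : R :=
  2^-1 * \sum_(l < n) invmx (gmat Q al x) k l *
    (partial i (fun y => gmat Q al y j l) x +
     partial j (fun y => gmat Q al y i l) x -
     partial l (fun y => gmat Q al y i j) x).

(* Curves are functions on R considered on an interval [a, b] only. A vector
   field along a curve [c] is given by its components: [W al t] are those of
   the vector at [c t] in the chart [al], relevant when [c t] is in the domain
   of [al]. *)
Definition velocity (a b : R) (c : R -> M) (al : chart R n M) : R -> 'rV[R]_n :=
  derive_in a b (coord al \o c).

Definition covariant (a b : R) (c : R -> M) (W : chart R n M -> R -> 'rV[R]_n)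
    (al : chart R n M) (t : R) : 'rV[R]_n :=
  \row_k (derive_in a b (W al) t 0 k +
    \sum_(i < n) \sum_(j < n) christoffel al (coord al (c t)) k i j *
      velocity a b c al t 0 i * W al t 0 j).

Definition speed (a b : R) (c : R -> M) (t : R) : R :=
  gnorm (c t) (velocity a b c ^~ t).

Definition accel_norm (a b : R) (c : R -> M) (t : R) : R :=
  gnorm (c t) (covariant a b c (velocity a b c) ^~ t).

Definition has_accel (a b : R) (c : R -> M) (t : R) : Prop :=
  derivable_in a b (velocity a b c (chart_at Q (c t))) t.

Definition curve_C (k : nat) (I : set R) (c : R -> M) : Prop :=
  (forall t, I t -> {for t, continuous c}) /\
  (forall al, atlas Q al ->
     class_C k (I `&` c @^-1` dom al) (coord al \o c : R^o -> 'rV[R]_n)).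

(* As usual, regularity on a compact interval means that there is an extension
   to an open neighbourhood with that regularity. *)
Definition on_segment (P : set R -> (R -> M) -> Prop) (a b : R) (c : R -> M)
    : Prop :=
  exists2 e : R, 0 < e &
  exists2 c' : R -> M, P `]a - e, b + e[%classic c' &
    forall t, a <= t <= b -> c' t = c t.

Definition C1_curve : R -> R -> (R -> M) -> Prop := on_segment (curve_C 1).

Definition smooth_curve : R -> R -> (R -> M) -> Prop :=
  on_segment (fun I c => forall k, curve_C k I c).

Definition piecewise_smooth (a b : R) (c : R -> M) : Prop :=
  exists (m : nat) (tau : nat -> R),
    [/\ tau 0%N = a, tau m = b &
        forall i, (i < m)%N ->
          tau i < tau i.+1 /\ smooth_curve (tau i) (tau i.+1) c].

Definition curve_length (a b : R) (c : R -> M) : \bar R :=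
  (\int[lebesgue_measure]_(t in `[a, b]) (speed a b c t)%:E)%E.

(* Extended-real valued, so that the infimum is also meaningful on a
   disconnected manifold; it is finite when [M] is connected. *)
Definition dist (p q : M) : \bar R :=
  ereal_inf [set l | exists a b : R, exists c : R -> M,
    [/\ a < b, piecewise_smooth a b c, c a = p, c b = q &
        l = curve_length a b c]].

Definition complete_mfd : Prop :=
  forall u : nat -> M,
    (forall e : R, 0 < e -> exists N, forall k l,
       (N <= k)%N -> (N <= l)%N -> (dist (u k) (u l) < e%:E)%E) ->
    exists p, forall e : R, 0 < e -> exists N, forall k,
       (N <= k)%N -> (dist (u k) p < e%:E)%E.

Definition C1_on_square (V : M * M -> R) : Prop :=
  forall al be, atlas Q al -> atlas Q be ->
    class_C 1 (codom al `*` codom be)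
      ((fun x => V (param al x.1, param be x.2))
        : 'rV[R]_n * 'rV[R]_n -> R^o).

Definition nearer (r : R) : set (M * M) :=
  [set z | (dist z.1 z.2 < r%:E)%E].

Definition farther (r : R) : set (M * M) :=
  [set z | (r%:E < dist z.1 z.2)%E].

End Riemannian.
Arguments riemannian : clear implicits.

Section CollisionAvoidance.
Context {R : realType} {n : nat} {M : topologicalType}.
Variables (Q : riemannian R n M) (s : nat) (T : R).

Definition neighbors (E : rel 'I_s) (i : 'I_s) : {set 'I_s} :=
  [set j | E i j]%SET.

Definition admissible (q0 qT : 'I_s -> M)
    (v0 : forall i, tangent Q (q0 i)) (vT : forall i, tangent Q (qT i))
    : set ('I_s -> R -> M) :=
  [set q | forall i,
    [/\ C1_curve Q 0 T (q i), piecewise_smooth Q 0 T (q i),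
        q i 0 = q0 i, q i T = qT i &
        forall al, atlas Q al ->
          (dom al (q0 i) -> velocity 0 T (q i) al 0 = v0 i al) /\
          (dom al (qT i) -> velocity 0 T (q i) al T = vT i al)]].

(* The integrands are non-negative, so the value in [0, +oo] is always
   meaningful. *)
Definition action (E : rel 'I_s) (V : 'I_s -> 'I_s -> M * M -> R)
    (q : 'I_s -> R -> M) : \bar R :=
  ((2^-1)%:E * \sum_(i < s) \int[lebesgue_measure]_(t in `[0%R, T])
     (accel_norm Q 0 T (q i) t ^+ 2 +
      2^-1 * \sum_(j in neighbors E i) V i j (q i t, q j t))%R%:E)%E.

Definition minimizer (Omega : set ('I_s -> R -> M))
    (J : ('I_s -> R -> M) -> \bar R) (q : 'I_s -> R -> M) : Prop :=
  Omega q /\ forall w, Omega w -> (J q <= J w)%E.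

(* The set is non-empty and bounded for [c] piecewise smooth and [0 < T]. *)
Definition max_accel (c : R -> M) : R :=
  sup [set x | exists t, [/\ 0 <= t <= T, has_accel Q 0 T c t &
                             x = accel_norm Q 0 T c t]].

Definition cost_bound (E : rel 'I_s) (Vm : 'I_s -> 'I_s -> R)
    (q : 'I_s -> R -> M) : R :=
  T * \sum_(i < s) (max_accel (q i) ^+ 2 + \sum_(j in neighbors E i) Vm i j).

Definition speed_bound (c : R) (p : M) (v : tangent Q p) : R :=
  Num.sqrt (c * T) + Num.sqrt (c * T + gnorm Q p v ^+ 2).

End CollisionAvoidance.

(* Main.v *)
(* Comparing a minimizer with the reference trajectory shows that its action is
   at most c/2, so the acceleration A of each of its curves satisfies
   int A^2 <= c. With k = sqrt(speed^2 + c T), metric compatibility gives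
   k' <= A <= l A^2 / 2 + 1 / (2 l), and integrating with l = sqrt(T / c) bounds
   the speed of agent i by v_i. If agents i and j were closer than r_ij at
   time t, they would stay in the risk region for a time
   (r*_ij - r_ij) / (v_i + v_j) on both sides of t, inside [0, T] because the
   end points are in the safety region; the potential term alone would then
   exceed c/2.

   The supremum a_i is meaningful only because the acceleration is bounded on
   each smooth piece, although [accel_norm] evaluates it at every time in an
   unrelated chart. This needs the transformation law of the acceleration,
   obtained by differentiating the compatibility of the matrices (g_ij) along
   the transition maps and using the symmetry of their second derivatives. *)

From Pilot Require Import Defs.
From HB Require Import structures.
From mathcomp Require Import all_boot all_order all_algebra.
From mathcomp Require Import all_classical all_reals all_analysis.
From mathcomp Require Import measurable_realfun ring lra.
Import Order.TTheory GRing.Theory Num.Theory numFieldNormedType.Exports.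
Local Open Scope classical_set_scope.
Local Open Scope ring_scope.
Set Implicit Arguments.
Unset Strict Implicit.
Unset Printing Implicit Defensive.

(* MathComp has its own [coord], [codom] and [gnorm], which would otherwise
   shadow those of [Defs]. *)
Import Pilot.Defs.

(** * Symmetry of second derivatives *)

Section Calculus.
Context {R : realType}.

(** The constant under the root in k keeps it differentiable where the speed vanishes. Any positive
    constant would serve; c T reproduces v_i, whose second root is then the value of k at time 0 and
    whose first root bounds the growth of k. Young's inequality is linear in A^2, so the integral of
    A^2 enters directly, without a Cauchy-Schwarz inequality for integrals. Norms are evaluated at
    each time in the chart chosen at that point, so their measurability is not evident. Upper bounds
    on lengths and actions are therefore comparisons of suprema over simple functions, and
    measurability of the acceleration is proved piece by piece only where integrals have to be added
    exactly. At a break point the acceleration may be a limit that does not exist. Estimates are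
    made inside the pieces and break points are discarded as null sets. The velocity is common to
    both sides of a break point because the curves are C^1, which lets the growth estimates of
    successive pieces telescope. *)

Lemma is_derive_line {V W : normedModType R} (f : V -> W) (x w : V) (s : R) :
  derivable f (x + s *: w) w ->
  is_derive s 1 (fun t : R => f (x + t *: w)) ('D_w f (x + s *: w)).
Proof.
move=> df.
have E : (fun h : R => h^-1 *: (f (x + (h *: 1 + s) *: w) - f (x + s *: w))) =
         (fun h : R => h^-1 *: (f (h *: w + (x + s *: w)) - f (x + s *: w))).
  apply/funext => h; congr (_ *: (f _ - _)).
  by rewrite [h *: 1]mulr1 scalerDl addrCA.
split.
  by rewrite /derivable /= E.
by rewrite /derive /= E.
Qed.

(** The mean value theorem is used twice: along [u] for the difference of [f] on two opposite sides
    of the parallelogram, then along [v] for ['D_u f]. *)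
Lemma second_difference {V : normedModType R} (f : V -> R^o) (x u v : V) (h : R) :
  0 < h ->
  (forall s t, 0 <= s <= h -> 0 <= t <= h ->
     [/\ derivable f (x + s *: u + t *: v) u &
         derivable ('D_u f) (x + s *: u + t *: v) v]) ->
  exists s t, [/\ 0 <= s <= h, 0 <= t <= h &
    f (x + h *: u + h *: v) - f (x + h *: u) - f (x + h *: v) + f x =
    h * h * 'D_v ('D_u f) (x + s *: u + t *: v)].
Proof.
move=> h0 H.
have h00 : 0 <= (0 : R) <= h by rewrite lexx ltW.
have hhh : 0 <= h <= h by rewrite lexx ltW.
pose p s := f (x + h *: v + s *: u) - f (x + s *: u).
pose dp s := 'D_u f (x + h *: v + s *: u) - 'D_u f (x + s *: u).
have dpP s : 0 <= s <= h -> is_derive s 1 (p : R -> R^o) (dp s).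
  move=> sh; apply: is_deriveB.
    have [] := H s h sh hhh; rewrite addrAC => df _.
    exact: (@is_derive_line _ _ f (x + h *: v) u s df).
  have [] := H s 0 sh h00; rewrite scale0r addr0 => df _.
  exact: (@is_derive_line _ _ f x u s df).
have ooh s : s \in `]0, h[ -> 0 <= s <= h.
  by rewrite in_itv/= => /andP[/ltW -> /ltW ->].
have pc : {within `[0, h], continuous p}.
  apply: derivable_within_continuous => s; rewrite in_itv/= => sh.
  by have [] := dpP s sh.
have [s /ooh sh Es] := MVT h0 (fun s sh => dpP s (ooh s sh)) pc.
pose k t := 'D_u f (x + s *: u + t *: v).
have dk t : 0 <= t <= h ->
    is_derive t 1 (k : R -> R^o) ('D_v ('D_u f) (x + s *: u + t *: v)).
  by move=> th; apply: is_derive_line; have [] := H s t sh th.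
have kc : {within `[0, h], continuous k}.
  apply: derivable_within_continuous => t; rewrite in_itv/= => th.
  by have [] := dk t th.
have [t /ooh th Et] := MVT h0 (fun s sh => dk s (ooh s sh)) kc.
exists s, t; split => //.
move: Es Et; rewrite /p /dp /k !scale0r !addr0 subr0 => Es Et.
rewrite [RHS](_ : _ = 'D_v ('D_u f) (x + s *: u + t *: v) * h * h); last by ring.
rewrite -Et.
rewrite (addrAC x (s *: u) (h *: v)) -Es.
rewrite (addrAC x (h *: v) (h *: u)).
by ring.
Qed.

(* The second difference on the parallelogram with sides [h *: u] and [h *: v]
   equals [h ^+ 2] times either mixed derivative at a nearby point. *)
Lemma derive_comm {V : normedModType R} (f : V -> R^o) (x u v : V) :
  (\forall y \near x, [/\ derivable f y u, derivable f y v,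
      derivable ('D_u f) y v & derivable ('D_v f) y u]) ->
  {for x, continuous ('D_v ('D_u f))} -> {for x, continuous ('D_u ('D_v f))} ->
  'D_v ('D_u f) x = 'D_u ('D_v f) x.
Proof.
move=> nf cvu cuv.
apply/eqP; rewrite -subr_eq0 -normr_le0; apply/ler_addgt0Pr => e e0.
rewrite add0r.
have e2 : 0 < e / 2 by rewrite divr_gt0.
move/cvgrPdist_lt : cvu => /(_ _ e2) n1.
move/cvgrPdist_lt : cuv => /(_ _ e2) n2.
have [d /= d0 dP] := (nbhs_ballP _ _).1 (filterI nf (filterI n1 n2)).
(* The [+ 1] keeps the denominator positive when [u] and [v] vanish, and makes the parallelogram lie
   strictly inside the ball of radius [d]. *)
pose h := d / (`|u| + `|v| + 1).
have k0 : 0 < `|u| + `|v| + 1 by rewrite ltr_wpDl ?addr_ge0.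
have h0 : 0 < h by rewrite divr_gt0.
have inb s t : 0 <= s <= h -> 0 <= t <= h -> ball x d (x + s *: u + t *: v).
  move=> /andP[s0 sh] /andP[t0 th].
  rewrite -ball_normE /= -addrA opprD addrA subrr add0r normrN.
  apply: (le_lt_trans (ler_normD _ _)); rewrite !normrZ !ger0_norm//.
  apply: (@le_lt_trans _ _ (h * `|u| + h * `|v|)).
    by apply: lerD; apply: ler_wpM2r.
  rewrite -mulrDr /h mulrAC ltr_pdivrMr// ltr_pM2l//.
  by rewrite ltrDl.
have [|s [t [sh th E1]]] := @second_difference V f x u v h h0.
  by move=> s t sh th; have [[]] := dP _ (inb s t sh th).
have [|t' [s' [sh' th' E2]]] := @second_difference V f x v u h h0.
  move=> s' t' sh' th'; rewrite (addrAC x (s' *: v) (t' *: u)).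
  by have [[_ k1 _ k2] _] := dP _ (inb t' s' th' sh'); split.
have E : 'D_v ('D_u f) (x + s *: u + t *: v) = 'D_u ('D_v f) (x + s' *: u + t' *: v).
  apply: (@mulfI _ (h * h)); first by rewrite mulf_neq0 ?gt_eqF.
  apply: (etrans (esym E1)); rewrite (addrAC x (s' *: u) (t' *: v)).
  apply: etrans E2; rewrite (addrAC x (h *: v) (h *: u)); ring.
have [_ [k1 _]] := dP _ (inb s t sh th).
have [_ [_ k2]] := dP _ (inb s' t' th' sh').
rewrite (splitr e) -[X in `|X|](subrKA ('D_v ('D_u f) (x + s *: u + t *: v))).
apply: (le_trans (ler_normD _ _)); apply: lerD; first exact: (ltW k1).
by rewrite E distrC; exact: (ltW k2).
Qed.

End Calculus.

(** * Matrix-valued functions and bilinear forms *)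

Section MatrixCalculus.
Context {R : realType}.

Lemma cvg_mx {T : Type} {F : set_system T} {FF : Filter F} m n
    (f : T -> 'M[R]_(m, n)) (l : 'M[R]_(m, n)) :
  (forall i j, f x i j @[x --> F] --> l i j) -> f x @[x --> F] --> l.
Proof.
move=> H; apply/cvgrPdist_le => /= e e0; near=> x.
rewrite /Num.Def.normr/= mx_normrE (bigmax_le _ (ltW e0))//= => i _.
rewrite !mxE/=; move: i; near: x; apply: filter_forall => /= i.
exact: ((cvgrPdist_le _ _).1 (H i.1 i.2)).
Unshelve. all: by end_near. Qed.

Lemma cvg_entry {T : Type} {F : set_system T} {FF : Filter F} m n
    (f : T -> 'M[R]_(m, n)) (l : 'M[R]_(m, n)) i j :
  f x @[x --> F] --> l -> f x i j @[x --> F] --> l i j.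
Proof. move=> H; exact: (cvg_comp _ _ H (@matrix_normedtype.coord_continuous _ _ _ i j l)). Qed.

Lemma cvg_sumr {T : Type} {F : set_system T} {FF : Filter F} (I : Type)
    (r : seq I) (P : pred I) (f : I -> T -> R) (l : I -> R) :
  (forall i, P i -> f i x @[x --> F] --> l i) ->
  \sum_(i <- r | P i) f i x @[x --> F] --> \sum_(i <- r | P i) l i.
Proof. by move=> H; apply: cvg_big => //; exact: add_continuous. Qed.

Lemma cvg_prodr {T : Type} {F : set_system T} {FF : Filter F} (I : Type)
    (r : seq I) (P : pred I) (f : I -> T -> R) (l : I -> R) :
  (forall i, P i -> f i x @[x --> F] --> l i) ->
  \prod_(i <- r | P i) f i x @[x --> F] --> \prod_(i <- r | P i) l i.
Proof. by move=> H; apply: cvg_big => //; exact: mul_continuous. Qed.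

Lemma cvg_mulmx {T : Type} {F : set_system T} {FF : Filter F} m n p
    (f : T -> 'M[R]_(m, n)) (g : T -> 'M[R]_(n, p)) (a : 'M[R]_(m, n)) (b : 'M[R]_(n, p)) :
  f x @[x --> F] --> a -> g x @[x --> F] --> b ->
  (f x *m g x) @[x --> F] --> a *m b.
Proof.
move=> fa gb; apply: cvg_mx => i j; rewrite !mxE.
under eq_cvg do rewrite mxE.
by apply: cvg_sumr => k _; apply: cvgM; exact: cvg_entry.
Qed.

Lemma cvg_trmx {T : Type} {F : set_system T} {FF : Filter F} m n
    (f : T -> 'M[R]_(m, n)) (a : 'M[R]_(m, n)) :
  f x @[x --> F] --> a -> (f x)^T @[x --> F] --> a^T.
Proof.
move=> fa; apply: cvg_mx => i j; rewrite !mxE.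
by under eq_cvg do rewrite mxE; exact: cvg_entry.
Qed.

Lemma cvg_bilin {T : Type} {F : set_system T} {FF : Filter F} n
    (A : T -> 'M[R]_n) (u v : T -> 'rV[R]_n) (a : 'M[R]_n) (b c : 'rV[R]_n) :
  A x @[x --> F] --> a -> u x @[x --> F] --> b -> v x @[x --> F] --> c ->
  bilin (A x) (u x) (v x) @[x --> F] --> bilin a b c.
Proof.
move=> Aa ub vc; apply: cvg_entry; apply: cvg_mulmx; last exact: cvg_trmx.
exact: cvg_mulmx.
Qed.

Lemma cvg_det {T : Type} {F : set_system T} {FF : Filter F} n
    (f : T -> 'M[R]_n) (a : 'M[R]_n) :
  f x @[x --> F] --> a -> \det (f x) @[x --> F] --> \det a.
Proof.
move=> fa; apply: cvg_sumr => s _; apply: cvgM; first exact: cvg_cst.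
by apply: cvg_prodr => i _; exact: cvg_entry.
Qed.

(** By Cramer's formula. [invmx] returns a singular matrix unchanged, so the formula is used only
    eventually along [F], where the determinant stays nonzero. *)
Lemma cvg_invmx {T : Type} {F : set_system T} {FF : Filter F} n
    (f : T -> 'M[R]_n) (a : 'M[R]_n) : a \in unitmx ->
  f x @[x --> F] --> a -> invmx (f x) @[x --> F] --> invmx a.
Proof.
move=> ua fa; have da : \det (f x) @[x --> F] --> \det a by exact: cvg_det.
have da0 : \det a != 0 by move: ua; rewrite unitmxE unitfE.
have H : ((\det (f x))^-1 *: \adj (f x)) @[x --> F] --> invmx a.
  rewrite /invmx ua; apply: cvg_mx => i j; rewrite !mxE.
  under eq_cvg do rewrite !mxE.
  have c1 : (\det (f x))^-1 @[x --> F] --> (\det a)^-1 by exact: cvgV.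
  have c2 : \det (row' j (col' i (f x))) @[x --> F] --> \det (row' j (col' i a)).
    apply: cvg_det; apply: cvg_mx => k l; rewrite !mxE.
    by under eq_cvg do rewrite !mxE; exact: cvg_entry.
  exact: cvgM c1 (cvgM (cvg_cst _) c2).
apply: cvg_trans H; apply: near_eq_cvg.
have : \forall x \near F, \det (f x) != 0.
  by move/cvgr_neq0 : da; apply.
by apply: filterS => x dx; rewrite /invmx unitmxE unitfE dx.
Qed.

Lemma is_derive_mxP {V : normedModType R} m n (M : V -> 'M[R]_(m, n)) x z dM :
  is_derive x z M dM <->
  forall i j, is_derive x z (fun y => M y i j : R^o) (dM i j).
Proof.
split=> [[d <-] i j|H].
  have e := (derivable_mxP M x z).1 d i j.
  by split => //; rewrite derive_mx// mxE.
have d : derivable M x z by apply/derivable_mxP => i j; have [] := H i j.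
split => //; rewrite derive_mx//; apply/matrixP => i j; rewrite mxE.
by have [] := H i j.
Qed.

Lemma is_derive_mulmx {V : normedModType R} m n p (A : V -> 'M[R]_(m, n))
    (B : V -> 'M[R]_(n, p)) x z dA dB :
  is_derive x z A dA -> is_derive x z B dB ->
  is_derive x z (fun y => A y *m B y) (dA *m B x + A x *m dB).
Proof.
move=> /is_derive_mxP hA /is_derive_mxP hB; apply/is_derive_mxP => i j.
rewrite (_ : (fun y => _) =
    \sum_(k < n) ((fun y => A y i k) * (fun y => B y k j))); last first.
  by apply/funext => y; rewrite mxE fct_sumE.
rewrite !mxE -big_split/=.
rewrite (_ : \sum_(k < n) _ =
  \sum_(k < n) (A x i k *: dB k j + B x k j *: dA i k)).
  by apply: is_derive_sum => k; apply: is_deriveM.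
by apply: eq_bigr => k _; rewrite addrC; congr (_ + _); rewrite mulrC.
Qed.

Lemma is_derive_trmx {V : normedModType R} m n (A : V -> 'M[R]_(m, n)) x z dA :
  is_derive x z A dA -> is_derive x z (fun y => (A y)^T) dA^T.
Proof.
move=> /is_derive_mxP hA; apply/is_derive_mxP => i j.
rewrite mxE (_ : (fun y => _) = (fun y => A y j i)); first exact: hA.
by apply/funext => y; rewrite mxE.
Qed.

Lemma is_derive_bilin {V : normedModType R} n (A : V -> 'M[R]_n)
    (u w : V -> 'rV[R]_n) x z dA du dw :
  is_derive x z A dA -> is_derive x z u du -> is_derive x z w dw ->
  is_derive x z (fun y => bilin (A y) (u y) (w y) : R^o)
    (bilin (A x) du (w x) + bilin dA (u x) (w x) + bilin (A x) (u x) dw).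
Proof.
move=> hA hu hw.
have /is_derive_mxP/(_ 0 0) := is_derive_mulmx (is_derive_mulmx hu hA) (is_derive_trmx hw).
by move=> h; apply: (is_derive_eq h); rewrite /bilin mulmxDl !mxE.
Qed.

Lemma bilinDl n (A : 'M[R]_n) u v w : bilin A (u + v) w = bilin A u w + bilin A v w.
Proof. by rewrite /bilin !mulmxDl mxE. Qed.

Lemma bilinDr n (A : 'M[R]_n) u v w : bilin A w (u + v) = bilin A w u + bilin A w v.
Proof. by rewrite /bilin linearD/= mulmxDr mxE. Qed.

Lemma bilinZl n (A : 'M[R]_n) k u w : bilin A (k *: u) w = k * bilin A u w.
Proof. by rewrite /bilin -!scalemxAl mxE. Qed.

Lemma bilinZr n (A : 'M[R]_n) k u w : bilin A w (k *: u) = k * bilin A w u.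
Proof. by rewrite /bilin linearZ/= -scalemxAr mxE. Qed.

Lemma bilinNN n (A : 'M[R]_n) u : bilin A (- u) (- u) = bilin A u u.
Proof. by rewrite -scaleN1r bilinZl bilinZr !mulN1r opprK. Qed.

Lemma bilin0r n (A : 'M[R]_n) w : bilin A w 0 = 0.
Proof. by rewrite -(scale0r 0) bilinZr mul0r. Qed.

Lemma bilin_sym n (A : 'M[R]_n) u w : A^T = A -> bilin A u w = bilin A w u.
Proof.
move=> sA; rewrite /bilin -[in LHS](trmxK (u *m A *m w^T)) mxE.
by rewrite !trmx_mul trmxK sA mulmxA.
Qed.

Lemma bilinE n (A : 'M[R]_n) u w : bilin A u w = \sum_i \sum_j u 0 i * A i j * w 0 j.
Proof.
rewrite /bilin mxE exchange_big/=; apply: eq_bigr => j _.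
by rewrite !mxE mulr_suml; apply: eq_bigr.
Qed.

Lemma bilin_CauchySchwarz n (A : 'M[R]_n) u w : A^T = A ->
  (forall v, v != 0 -> 0 < bilin A v v) ->
  bilin A u w ^+ 2 <= bilin A u u * bilin A w w.
Proof.
move=> sA pA; have [->|w0] := eqVneq w 0.
  by rewrite !bilin0r expr0n mulr0.
have ww := pA _ w0.
have pA' v : 0 <= bilin A v v.
  have [->|/pA/ltW//] := eqVneq v 0.
  by rewrite bilin0r.
(* This is the component of [u] orthogonal to [w], scaled by [bilin A w w] to avoid a division. *)
have := pA' (bilin A w w *: u + (- bilin A u w) *: w).
rewrite !(bilinDl, bilinDr, bilinZl, bilinZr) (bilin_sym w u)//.
move: (bilin A u w) (bilin A u u) (bilin A w w) ww => a b c c0 H.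
have {}H : 0 <= c * (b * c - a ^+ 2).
  by apply: le_trans H _; rewrite le_eqVlt; apply/orP; left; apply/eqP; ring.
by move: H; rewrite pmulr_rge0// subr_ge0.
Qed.

(** A nonzero row of the kernel would be a vector [v] with [v *m A = 0], hence with
    [bilin A v v = 0]. *)
Lemma posdef_unitmx n (A : 'M[R]_n) :
  (forall v, v != 0 -> 0 < bilin A v v) -> A \in unitmx.
Proof.
move=> pA; rewrite -row_free_unit -kermx_eq0; apply/eqP/row_matrixP => i.
rewrite row0; apply/eqP; apply: contraT => /pA.
by rewrite /bilin -row_mul mulmx_ker row0 mul0mx mxE ltxx.
Qed.

Lemma is_derive_chain {U V W : normedModType R} (g : V -> W) (f : U -> V) x z :
  differentiable f x -> differentiable g (f x) ->
  is_derive x z (g \o f) ('D_('D_z f x) g (f x)).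
Proof.
move=> df dg; have dgf := differentiable_comp df dg.
split; first exact: diff_derivable.
by rewrite !deriveE// diff_comp.
Qed.

End MatrixCalculus.

(** * Charts and Christoffel symbols *)

Section Charts.
Context {R : realType} {n : nat} {M : topologicalType}.
Variable Q : riemannian R n M.
Implicit Types (al be : chart R n M) (u v w z x : 'rV[R]_n).

Definition dgmat al x v : 'M[R]_n :=
  \matrix_(i, j) 'D_v (fun y => gmat Q al y i j : R^o) x.

(** The quadratic term of the geodesic equation: the covariant acceleration is the second derivative
    of the coordinates plus this row at the velocity. *)
Definition christoffel_row al x v : 'rV[R]_n :=
  \row_k \sum_(i < n) \sum_(j < n) christoffel Q al x k i j * v 0 i * v 0 j.

Lemma derive_deltaE {W : normedModType R} (f : 'rV[R]_n -> W) x v :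
  differentiable f x -> 'D_v f x = \sum_i v 0 i *: 'D_(delta_mx 0 i) f x.
Proof.
move=> df; rewrite deriveE// {1}(row_sum_delta v) linear_sum/=.
by apply: eq_bigr => i _; rewrite linearZ deriveE.
Qed.

Lemma gmat_differentiable al x (i j : 'I_n) : atlas Q al -> codom al x ->
  differentiable (fun y => gmat Q al y i j : R^o) x.
Proof. by move=> aal xal; have [+ _] := gmat_smooth aal i j 1; apply. Qed.

Lemma gmat_derive_continuous al x v (i j : 'I_n) : atlas Q al -> codom al x ->
  {for x, continuous (fun y => 'D_v (fun y => gmat Q al y i j : R^o) y)}.
Proof. by move=> aal xal; have [_ /(_ v)] := gmat_smooth aal i j 1; apply. Qed.

Lemma codom_coord al p : dom al p -> codom al (coord al p).
Proof. by move=> dp; exists p. Qed.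

(* With the index lowered the inverse of (g_ij) disappears, which makes the
   expression easy to transform under a change of charts. *)
Lemma gmat_christoffel al x v w : atlas Q al -> codom al x ->
  bilin (gmat Q al x) (christoffel_row al x v) w =
  bilin (dgmat al x v) v w - 2^-1 * bilin (dgmat al x w) v v.
Proof.
move=> aal xal.
have sg := gmat_sym aal xal.
have ug := posdef_unitmx (gmat_pos aal xal).
pose P i j l := partial i (fun y => gmat Q al y j l) x.
have Dg z j l : 'D_z (fun y => gmat Q al y j l : R^o) x = \sum_i z 0 i * P i j l.
  by rewrite derive_deltaE//; exact: gmat_differentiable.
(* Twice the Christoffel symbols of the first kind, contracted with [v] in both slots. *)
pose L : 'rV[R]_n := \row_l \sum_i \sum_j (P i j l + P j i l - P l i j) * v 0 i * v 0 j.
have -> : christoffel_row al x v = 2^-1 *: (L *m invmx (gmat Q al x)).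
  apply/rowP => k; rewrite !mxE.
  under [in RHS]eq_bigr do rewrite mxE mulr_suml.
  rewrite [X in 2^-1 * X]exchange_big mulr_sumr; apply: eq_bigr => i _ /=.
  under [in RHS]eq_bigr do rewrite mulr_suml.
  rewrite [X in 2^-1 * X]exchange_big mulr_sumr; apply: eq_bigr => j _ /=.
  rewrite /christoffel -!mulrA; congr (_ * _).
  rewrite mulr_suml; apply: eq_bigr => l _.
  have -> : invmx (gmat Q al x) l k = invmx (gmat Q al x) k l.
    by rewrite -[in LHS]sg -trmx_inv mxE.
  by rewrite /P; ring.
rewrite bilinZl {1}/bilin mulmxKV// !bilinE mxE.
under eq_bigr => l _ do rewrite !mxE.
transitivity (2^-1 * \sum_l \sum_i \sum_j
   (P i j l + P j i l - P l i j) * v 0 i * v 0 j * w 0 l).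
  congr (_ * _); apply: eq_bigr => l _; rewrite mulr_suml.
  by apply: eq_bigr => i _; rewrite mulr_suml.
(* The terms [P i j l] and [P j i l] have the same sum, since [i] and [j] are both contracted with
   [v]. Together they absorb the factor [2^-1], which survives only in front of the third term. *)
have S1 : \sum_i \sum_j v 0 i * dgmat al x v i j * w 0 j =
    \sum_l \sum_i \sum_j P i j l * v 0 i * v 0 j * w 0 l.
  rewrite exchange_big; apply: eq_bigr => l _ /=.
  rewrite [RHS]exchange_big; apply: eq_bigr => j _ /=.
  rewrite mxE Dg mulr_sumr mulr_suml; apply: eq_bigr => i _; ring.
have S2 : \sum_i \sum_j v 0 i * dgmat al x v i j * w 0 j =
    \sum_l \sum_i \sum_j P j i l * v 0 i * v 0 j * w 0 l.
  rewrite S1; apply: eq_bigr => l _; rewrite exchange_big /=.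
  by apply: eq_bigr => i _; apply: eq_bigr => j _; ring.
have S3 : \sum_i \sum_j v 0 i * dgmat al x w i j * v 0 j =
    \sum_l \sum_i \sum_j P l i j * v 0 i * v 0 j * w 0 l.
  rewrite [RHS]exchange_big; apply: eq_bigr => i _ /=.
  rewrite [RHS]exchange_big; apply: eq_bigr => j _ /=.
  rewrite mxE Dg mulr_sumr mulr_suml; apply: eq_bigr => l _; ring.
rewrite S3 [X in X - _](_ : _ = 2^-1 * (\sum_l \sum_i \sum_j P i j l * v 0 i * v 0 j * w 0 l +
  \sum_l \sum_i \sum_j P j i l * v 0 i * v 0 j * w 0 l)); last first.
  by rewrite -S1 -S2; field.
rewrite -mulrBr -big_split/= -sumrB; congr (_ * _); apply: eq_bigr => l _.
rewrite -big_split/= -sumrB; apply: eq_bigr => i _.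
rewrite -big_split/= -sumrB; apply: eq_bigr => j _.
by ring.
Qed.


Lemma continuous_near_eq {S U : topologicalType} (f g : S -> U) (y : S) :
  (\forall z \near y, f z = g z) -> {for y, continuous g} -> {for y, continuous f}.
Proof.
move=> fg cg; rewrite /prop_for /continuous_at (nbhs_singleton fg).
by apply: cvg_trans cg; apply: near_eq_cvg; apply: filterS fg => z ->.
Qed.

Definition overlap al be := coord al @` (dom al `&` dom be).

(** The image of [dom al] is open, and [param al] is continuous at [coord al p] with value [p] in
    the open set [dom be]. *)
Lemma overlap_near al be p : dom al p -> dom be p ->
  \forall x \near coord al p, overlap al be x.
Proof.
move=> dp dp'.
have xC : (coord al @` dom al) (coord al p) by exists p.
have n1 : nbhs (coord al p) (coord al @` dom al).
  exact: (open_nbhs_nbhs (conj (@codom_open _ _ _ al) xC)).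
have n2 : nbhs (coord al p) (param al @^-1` dom be).
  apply: (param_continuous xC); rewrite coordK//.
  exact: (open_nbhs_nbhs (conj (dom_open be) dp')).
near=> x.
have [p' dp1 xE] : (coord al @` dom al) x by near: x.
have : dom be (param al x) by near: x.
by rewrite -xE coordK// => dp2; exists p'.
Unshelve. all: by end_near. Qed.

Lemma transition_coord al be p : dom al p ->
  transition al be (coord al p) = coord be p.
Proof. by move=> dp; rewrite /transition/= coordK. Qed.

Lemma overlap_codom al be x : overlap al be x -> codom al x.
Proof. by move=> [p [dp _] <-]; exists p. Qed.

Lemma overlap_codom_transition al be x : overlap al be x ->
  codom be (transition al be x).
Proof. by move=> [p [dp dp'] <-]; rewrite transition_coord//; exists p. Qed.

Section Transition.
Variables (al be : chart R n M) (p : M).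
Hypotheses (aal : atlas Q al) (abe : atlas Q be) (dal : dom al p) (dbe : dom be p).
Let phi := transition al be.
Let x := coord al p.

Lemma transition_differentiable y : overlap al be y -> differentiable phi y.
Proof. by move=> oy; have [+ _] := transition_smooth aal abe 1; apply. Qed.

Lemma transition_derive_differentiable y v : overlap al be y ->
  differentiable ('D_v phi) y.
Proof. by move=> oy; have [_ /(_ v)[+ _]] := transition_smooth aal abe 2; apply. Qed.

Lemma transition_derive2_continuous y v w : overlap al be y ->
  {for y, continuous ('D_w ('D_v phi))}.
Proof. by move=> oy; have [_ /(_ v)[_ /(_ w)]] := transition_smooth aal abe 2; apply. Qed.

Lemma derive_entry (f : 'rV[R]_n -> 'rV[R]_n) v y k : differentiable f y ->
  'D_v (fun y => f y 0 k : R^o) y = ('D_v f y) 0 k.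
Proof.
by move=> df; rewrite [in RHS]derive_mx ?mxE//; exact: diff_derivable.
Qed.

Lemma derivable_entry (f : 'rV[R]_n -> 'rV[R]_n) v y k : differentiable f y ->
  derivable (fun y => f y 0 k : R^o) y v.
Proof. by move=> df; apply: (derivable_mxP f y v).1; exact: diff_derivable. Qed.

(** Componentwise, since [derive_comm] concerns scalar functions. Taking an entry commutes with a
    derivative only where the map is differentiable, so each identity is kept on a neighbourhood of
    [x], where it can be differentiated again. *)
Lemma transition_derive_comm v w : 'D_v ('D_w phi) x = 'D_w ('D_v phi) x.
Proof.
apply/rowP => k.
have on : \forall y \near x, overlap al be y by exact: overlap_near.
have E z : \forall y \near x, 'D_z (fun y => phi y 0 k : R^o) y = ('D_z phi y) 0 k.
  near=> y; apply: derive_entry; apply: transition_differentiable; near: y.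
  exact: on.
have ox := nbhs_singleton on.
have E2 z z' : \forall y \near x, 'D_z' ('D_z (fun y => phi y 0 k : R^o)) y =
                       ('D_z' ('D_z phi) y) 0 k.
  near=> y; rewrite -derive_entry.
    by apply: near_eq_derive; near: y; exact: (near_join (E z)).
  apply: transition_derive_differentiable; near: y; exact: on.
apply: (etrans (esym (nbhs_singleton (E2 w v)))).
apply: etrans (nbhs_singleton (E2 v w)).
have c2 z z' : {for x, continuous ('D_z' ('D_z (fun y => phi y 0 k : R^o)))}.
  apply: continuous_near_eq (E2 z z') _.
  have h := @transition_derive2_continuous x z z' ox.
  exact: (cvg_entry (i := 0) (j := k) h).
have dd z z' : \forall y \near x,
    derivable ('D_z (fun y => phi y 0 k : R^o)) y z'.
  apply: filterS2 (near_join (E z)) on => y Ey oy.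
  apply: (@near_eq_derivable _ _ _ (fun y => ('D_z phi y) 0 k : R^o)).
    by apply: filterS Ey => ? ->.
  by apply: derivable_entry; exact: transition_derive_differentiable.
apply: derive_comm (c2 w v) (c2 v w).
apply: filterS3 on (dd w v) (dd v w) => y oy d1 d2.
have d z : derivable (fun y => phi y 0 k : R^o) y z.
  by apply: derivable_entry; exact: transition_differentiable.
by split; [exact: d|exact: d|exact: d1|exact: d2].
Unshelve. all: by end_near. Qed.
End Transition.

End Charts.

(** * Chart independence of the acceleration *)

Section Curves.
Context {R : realType} {n : nat} {M : topologicalType}.
Variable Q : riemannian R n M.
Implicit Types (al be : chart R n M) (u v w z x : 'rV[R]_n).

Lemma is_derive_gmat al x v : atlas Q al -> codom al x ->
  is_derive x v (gmat Q al) (dgmat Q al x v).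
Proof.
move=> aal cx; apply/is_derive_mxP => i j; rewrite mxE; apply: derivableP.
by apply: diff_derivable; exact: gmat_differentiable.
Qed.

Lemma is_derive_gmat_comp {V : normedModType R} (f : V -> 'rV[R]_n) al (y v : V) :
  atlas Q al -> codom al (f y) -> differentiable f y ->
  is_derive y v (fun s => gmat Q al (f s)) (dgmat Q al (f y) ('D_v f y)).
Proof.
move=> aal cx df; apply/is_derive_mxP => i j; rewrite mxE.
exact: (is_derive_chain v df (gmat_differentiable i j aal cx)).
Qed.

Section Transition.
Variables (al be : chart R n M) (p : M).
Hypotheses (aal : atlas Q al) (abe : atlas Q be) (dal : dom al p) (dbe : dom be p).
Let phi := transition al be.
Let x := coord al p.

Lemma gmat_transition y u w : overlap al be y ->
  bilin (gmat Q al y) u w =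
  bilin (gmat Q be (phi y)) ('D_u phi y) ('D_w phi y).
Proof.
move=> oy; have dphi : differentiable phi y by exact: (transition_differentiable aal abe).
rewrite !deriveE//; case: oy dphi => q [dq dq'] <- _.
by rewrite (gmat_compat aal abe)// /phi transition_coord.
Qed.

(** The product rule applied to [gmat_transition] with [u] and [w] constant. That identity holds on
    a neighbourhood of [x], so both sides have the same derivative along [z]. *)
Lemma dgmat_transition z u w :
  bilin (dgmat Q al x z) u w =
  bilin (gmat Q be (phi x)) ('D_z ('D_u phi) x) ('D_w phi x) +
  bilin (dgmat Q be (phi x) ('D_z phi x)) ('D_u phi x) ('D_w phi x) +
  bilin (gmat Q be (phi x)) ('D_u phi x) ('D_z ('D_w phi) x).
Proof.
have on := overlap_near dal dbe.
have ox := nbhs_singleton on.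
have dD v : is_derive x z ('D_v phi) ('D_z ('D_v phi) x).
  apply: derivableP; apply: diff_derivable.
  exact: (transition_derive_differentiable aal abe).
have h1 := is_derive_bilin (is_derive_gmat z aal (overlap_codom ox))
  (is_derive_cst u x z) (is_derive_cst w x z).
have h2 := is_derive_bilin (is_derive_gmat_comp z abe (overlap_codom_transition ox)
  (transition_differentiable aal abe ox)) (dD u) (dD w).
move: h1; rewrite !bilin0r bilin_sym ?bilin0r ?addr0 ?add0r; last first.
  by apply: gmat_sym => //; exact: overlap_codom ox.
move=> h1; rewrite -(@derive_val _ _ _ _ _ _ _ h1) -(@derive_val _ _ _ _ _ _ _ h2).
apply: near_eq_derive; apply: filterS on => y oy.
exact: gmat_transition.
Qed.
End Transition.

(* [H] and [K] stand for the second derivatives of the transition map in the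
   directions (v, v) and (v, w). *)
Lemma lowered_acceleration_transition (ga gb dav daw dbV dbW : 'M[R]_n)
    (a Ga Gb v w V W A H K : 'rV[R]_n) :
  gb^T = gb ->
  bilin gb Gb W = bilin dbV V W - 2^-1 * bilin dbW V V ->
  bilin ga Ga w = bilin dav v w - 2^-1 * bilin daw v v ->
  bilin dav v w = bilin gb H W + bilin dbV V W + bilin gb V K ->
  bilin daw v v = bilin gb K V + bilin dbW V V + bilin gb V K ->
  bilin ga a w = bilin gb A W ->
  bilin gb (A + H + Gb) W = bilin ga (a + Ga) w.
Proof.
move=> sg e1 e2 e3 e4 e5.
by rewrite !bilinDl e1 e2 e3 e4 e5 (bilin_sym K V sg); field.
Qed.

(** A two-sided derivative, for curves extended to an open interval, where ordinary differential
    calculus applies. It agrees with [velocity] inside a smooth piece. *)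
Definition cvel (c : R -> M) al : R^o -> 'rV[R]_n :=
  'D_1 (coord al \o c : R^o -> 'rV[R]_n).

Definition cacc (c : R -> M) al (t : R^o) : 'rV[R]_n :=
  'D_1 (cvel c al) t + christoffel_row Q al (coord al (c t)) (cvel c al t).

Section C2.
Variables (I : set R) (c : R -> M).
Hypotheses (oI : open I) (cc : curve_C Q 2 I c).
Implicit Types t : R^o.

Lemma curve_near_dom al t : I t -> dom al (c t) ->
  \forall s \near t, I s /\ dom al (c s).
Proof.
move=> It dt; have [cont _] := cc.
have n1 : nbhs t I by exact: open_nbhs_nbhs.
have n2 : nbhs t (c @^-1` dom al).
  by apply: (cont _ It); exact: (open_nbhs_nbhs (conj (dom_open al) dt)).
exact: filterI n1 n2.
Qed.

Lemma curve_differentiable al t : atlas Q al -> I t -> dom al (c t) ->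
  differentiable (coord al \o c : R^o -> 'rV[R]_n) t.
Proof. by move=> aal It dt; have [_ /(_ _ aal)[+ _]] := cc; apply. Qed.

Lemma cvel_differentiable al t : atlas Q al -> I t -> dom al (c t) ->
  differentiable (cvel c al) t.
Proof. by move=> aal It dt; have [_ /(_ _ aal)[_ /(_ 1)[+ _]]] := cc; apply. Qed.

Lemma cvel_derive_continuous al t : atlas Q al -> I t -> dom al (c t) ->
  {for t, continuous ('D_1 (cvel c al))}.
Proof. by move=> aal It dt; have [_ /(_ _ aal)[_ /(_ 1)[_ /(_ 1)]]] := cc; apply. Qed.

Section TwoCharts.
Variables al be : chart R n M.
Hypotheses (aal : atlas Q al) (abe : atlas Q be).
Let phi := transition al be.

Lemma cvel_transition t : I t -> dom al (c t) -> dom be (c t) ->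
  cvel c be t = 'D_(cvel c al t) phi (coord al (c t)).
Proof.
move=> It dt dt'.
have dX := curve_differentiable aal It dt.
have ox := nbhs_singleton (overlap_near dt dt').
have dphi := transition_differentiable aal abe ox.
rewrite -(@derive_val _ _ _ _ _ _ _ (is_derive_chain (1 : R^o) dX dphi)).
apply: near_eq_derive; apply: filterS (curve_near_dom It dt) => s [_ ds] /=.
by rewrite transition_coord.
Qed.

Lemma cvel_derive_transition t : I t -> dom al (c t) -> dom be (c t) ->
  'D_1 (cvel c be) t = 'D_('D_1 (cvel c al) t) phi (coord al (c t)) +
    'D_(cvel c al t) ('D_(cvel c al t) phi) (coord al (c t)).
Proof.
move=> It dt dt'; set x := coord al (c t); set v := cvel c al t.
have ox : overlap al be x by exact: nbhs_singleton (overlap_near dt dt').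
have dX := curve_differentiable aal It dt.
have dD i : differentiable ('D_(delta_mx 0 i) phi) x.
  exact: (transition_derive_differentiable aal abe).
have dv : is_derive t 1 (cvel c al) ('D_1 (cvel c al) t).
  by apply: derivableP; apply: diff_derivable; exact: cvel_differentiable.
pose J (s : R^o) : 'M[R]_n := jacobian phi (coord al (c s)).
(* In ['D_v phi] along the curve both the direction and the base point move. Written as [v *m J'] it
   is a product of two differentiable factors, to which the product rule applies. *)
pose J' (s : R^o) : 'M[R]_n := \matrix_i 'D_(delta_mx 0 i) phi (coord al (c s)).
pose dJ : 'M[R]_n := \matrix_i 'D_v ('D_(delta_mx 0 i) phi) x.
have vJ u s : overlap al be (coord al (c s)) -> 'D_u phi (coord al (c s)) = u *m J' s.
  move=> os; have ds := transition_differentiable aal abe os.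
  rewrite derive_deltaE// mulmx_sum_row; apply: eq_bigr => i _.
  by rewrite rowK.
have dJP : is_derive t 1 J' dJ.
  apply/is_derive_mxP => i j; rewrite !mxE.
  rewrite (_ : (fun y => _) =
     (fun s : R^o => ('D_(delta_mx 0 i) phi (coord al (c s))) 0 j)); last first.
    by apply/funext => s; rewrite !mxE.
  exact: ((is_derive_mxP _ _ _ _).1 (is_derive_chain (1 : R^o) dX (dD i)) 0 j).
have h := is_derive_mulmx dv dJP.
transitivity ('D_1 (fun s => cvel c al s *m J' s) t).
  apply: near_eq_derive.
  apply: filterS2 (curve_near_dom It dt) (curve_near_dom It dt') => s [Is ds] [_ ds'].
  rewrite (cvel_transition Is ds ds') vJ//.
  exact: nbhs_singleton (overlap_near ds ds').
rewrite (@derive_val _ _ _ _ _ _ _ h) -vJ//; congr (_ + _).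
rewrite mulmx_sum_row [RHS]derive_deltaE; last first.
  exact: (transition_derive_differentiable aal abe).
(* Differentiating the Jacobian along the curve gives the mixed derivatives in the wrong order;
   their symmetry lets the sum recombine into ['D_v ('D_v phi)]. *)
have rE i : row i dJ = 'D_(delta_mx 0 i) ('D_v phi) x.
  rewrite /dJ rowK.
  exact: (transition_derive_comm aal abe dt dt' v (delta_mx 0 i)).
by under eq_bigr do rewrite rE.
Qed.

(** The transformation law in weak form: the acceleration is paired with an arbitrary vector,
    because [gmat_christoffel] describes the Christoffel term through such pairings. *)
Lemma cacc_transition t w : I t -> dom al (c t) -> dom be (c t) ->
  bilin (gmat Q be (coord be (c t))) (cacc c be t) ('D_w phi (coord al (c t))) =
  bilin (gmat Q al (coord al (c t))) (cacc c al t) w.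
Proof.
move=> It dt dt'.
have ox : overlap al be (coord al (c t)) by exact: nbhs_singleton (overlap_near dt dt').
have cx : codom al (coord al (c t)) by exact: codom_coord.
have cy : codom be (phi (coord al (c t))) by exact: (overlap_codom_transition ox).
have yE : phi (coord al (c t)) = coord be (c t) by exact: transition_coord.
have e1 := gmat_christoffel ('D_(cvel c al t) phi (coord al (c t)))
             ('D_w phi (coord al (c t))) abe cy.
have e2 := gmat_christoffel (cvel c al t) w aal cx.
have e3 := dgmat_transition aal abe dt dt' (cvel c al t) (cvel c al t) w.
have e4 := dgmat_transition aal abe dt dt' w (cvel c al t) (cvel c al t).
have e5 := gmat_transition aal abe ('D_1 (cvel c al) t) w ox.
have comm := transition_derive_comm aal abe dt dt' w (cvel c al t).
rewrite comm in e4.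
have := lowered_acceleration_transition (gmat_sym abe cy) e1 e2 e3 e4 e5.
rewrite -/phi yE => <-; rewrite /cacc.
by rewrite -(cvel_derive_transition It dt dt') -(cvel_transition It dt dt').
Qed.

End TwoCharts.

End C2.
End Curves.

(** * Squared speed, squared acceleration and power along a C^2 curve *)

Section CurveNorms.
Context {R : realType} {n : nat} {M : topologicalType}.
Variable Q : riemannian R n M.
Implicit Types (al be : chart R n M) (c : R -> M) (t : R^o).

Definition gmat_along c al t := gmat Q al (coord al (c t)).

Definition sqspeed_in al c t : R^o :=
  bilin (gmat_along c al t) (cvel c al t) (cvel c al t).

Definition sqaccel_in al c t : R^o :=
  bilin (gmat_along c al t) (cacc Q c al t) (cacc Q c al t).

Definition power_in al c t : R^o :=
  bilin (gmat_along c al t) (cacc Q c al t) (cvel c al t).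

(** The chart varies with [t], as in [gnorm]. Continuity and derivatives are therefore established
    in the chart of one fixed time, where the two versions coincide nearby. *)
Definition sqspeed c t := sqspeed_in (chart_at Q (c t)) c t.
Definition sqaccel c t := sqaccel_in (chart_at Q (c t)) c t.
Definition power c t := power_in (chart_at Q (c t)) c t.

Section C2.
Variables (I : set R) (c : R -> M).
Hypotheses (oI : open I) (cc : curve_C Q 2 I c).

(** The algebra behind metric compatibility: by the second premise the derivative [d] of the metric
    along [v] contributes [bilin d v v], which is exactly twice the Christoffel term paired with
    [v]. *)
Lemma lowered_power (g d : 'M[R]_n) (v a G : 'rV[R]_n) : g^T = g ->
  bilin g G v = bilin d v v - 2^-1 * bilin d v v ->
  bilin g a v + bilin d v v + bilin g v a = 2 * bilin g (a + G) v.
Proof. by move=> sg e; rewrite bilinDl e (bilin_sym v a sg); field. Qed.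

Lemma gmat_along_sym al t : atlas Q al -> dom al (c t) ->
  (gmat_along c al t)^T = gmat_along c al t.
Proof. by move=> aal dt; apply: gmat_sym => //; exact: codom_coord. Qed.

Lemma gmat_along_pos al t v : atlas Q al -> dom al (c t) ->
  v != 0 -> 0 < bilin (gmat_along c al t) v v.
Proof. by move=> aal dt; apply: gmat_pos => //; exact: codom_coord. Qed.

Lemma gmat_along_ge0 al t v : atlas Q al -> dom al (c t) ->
  0 <= bilin (gmat_along c al t) v v.
Proof.
move=> aal dt; have [->|v0] := eqVneq v 0; first by rewrite bilin0r.
by apply: ltW; exact: gmat_along_pos.
Qed.

Lemma gmat_along_transition al be t u w : atlas Q al -> atlas Q be ->
  dom al (c t) -> dom be (c t) ->
  bilin (gmat_along c al t) u w =
  bilin (gmat_along c be t) ('D_u (transition al be) (coord al (c t)))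
                            ('D_w (transition al be) (coord al (c t))).
Proof.
move=> aal abe dt dt'; have ox := nbhs_singleton (overlap_near dt dt').
by rewrite /gmat_along (gmat_transition aal abe _ _ ox) transition_coord.
Qed.

Lemma sqspeed_chart al be t : atlas Q al -> atlas Q be -> I t ->
  dom al (c t) -> dom be (c t) -> sqspeed_in al c t = sqspeed_in be c t.
Proof.
move=> aal abe It dt dt'.
rewrite /sqspeed_in (gmat_along_transition _ _ aal abe dt dt').
by rewrite -(cvel_transition oI cc aal abe It dt dt').
Qed.

(* Cauchy-Schwarz in the chart [be]; exchanging the charts gives equality, and
   the derivative of the transition map need not be inverted. *)
Lemma sqaccel_chart_le al be t : atlas Q al -> atlas Q be -> I t ->
  dom al (c t) -> dom be (c t) -> sqaccel_in al c t <= sqaccel_in be c t.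
Proof.
move=> aal abe It dt dt'.
pose W := 'D_(cacc Q c al t) (transition al be) (coord al (c t)).
have e1 : sqaccel_in al c t = bilin (gmat_along c be t) (cacc Q c be t) W.
  by rewrite /sqaccel_in /W (cacc_transition oI cc aal abe _ It dt dt').
have e2 : sqaccel_in al c t = bilin (gmat_along c be t) W W.
  by rewrite /sqaccel_in (gmat_along_transition _ _ aal abe dt dt').
have := bilin_CauchySchwarz (cacc Q c be t) W (gmat_along_sym abe dt')
  (fun v => gmat_along_pos abe dt').
rewrite -e1 -e2 -/(sqaccel_in be c t).
have p1 : 0 <= sqaccel_in al c t by exact: gmat_along_ge0.
have p2 : 0 <= sqaccel_in be c t by exact: gmat_along_ge0.
move: p1 p2; move: (sqaccel_in al c t) (sqaccel_in be c t) => a b.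
rewrite le_eqVlt => /predU1P[<- //|a0] b0 h.
by move: h; rewrite expr2 [X in _ <= X]mulrC ler_pM2l.
Qed.

Lemma sqaccel_chart al be t : atlas Q al -> atlas Q be -> I t ->
  dom al (c t) -> dom be (c t) -> sqaccel_in al c t = sqaccel_in be c t.
Proof.
move=> aal abe It dt dt'.
apply: le_anti; apply/andP; split.
  exact: (sqaccel_chart_le aal abe It dt dt').
exact: (sqaccel_chart_le abe aal It dt' dt).
Qed.

Lemma cvg_coord_comp (W : topologicalType) (f : 'rV[R]_n -> W) al t :
  atlas Q al -> I t -> dom al (c t) ->
  {for coord al (c t), continuous f} ->
  f (coord al (c s)) @[s --> t] --> f (coord al (c t)).
Proof.
move=> aal It dt cf.
have h := differentiable_continuous (curve_differentiable cc aal It dt).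
exact: (cvg_comp _ _ h cf).
Qed.

Lemma gmat_along_continuous al t : atlas Q al -> I t -> dom al (c t) ->
  gmat_along c al s @[s --> t] --> gmat_along c al t.
Proof.
move=> aal It dt; apply: cvg_mx => i j.
apply: (cvg_coord_comp (f := fun y => gmat Q al y i j : R^o)) => //.
apply: differentiable_continuous; apply: gmat_differentiable => //.
exact: codom_coord.
Qed.

Lemma christoffel_continuous al t k i j : atlas Q al -> I t -> dom al (c t) ->
  christoffel Q al (coord al (c s)) k i j @[s --> t] -->
  christoffel Q al (coord al (c t)) k i j.
Proof.
move=> aal It dt; apply: cvgM; first exact: cvg_cst.
apply: cvg_sumr => l _; apply: cvgM.
  apply: cvg_entry; apply: cvg_invmx; last exact: gmat_along_continuous.
  by apply: posdef_unitmx => v; exact: gmat_along_pos.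
have h a b d : partial a (fun y => gmat Q al y b d) (coord al (c s)) @[s --> t] -->
    partial a (fun y => gmat Q al y b d) (coord al (c t)).
  apply: (cvg_coord_comp (f := partial a (fun y => gmat Q al y b d))) => //.
  apply: gmat_derive_continuous => //; exact: codom_coord.
by apply: cvgB; [apply: cvgD|]; exact: h.
Qed.

Lemma cvel_continuous al t : atlas Q al -> I t -> dom al (c t) ->
  cvel c al s @[s --> t] --> cvel c al t.
Proof.
move=> aal It dt; apply: differentiable_continuous.
exact: (cvel_differentiable cc aal It dt).
Qed.

Lemma cacc_continuous al t : atlas Q al -> I t -> dom al (c t) ->
  cacc Q c al s @[s --> t] --> cacc Q c al t.
Proof.
move=> aal It dt; have cv := cvel_continuous aal It dt.
apply: cvgD; first exact: (cvel_derive_continuous cc aal It dt).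
apply: cvg_mx => i k; rewrite !mxE; under eq_cvg do rewrite mxE.
apply: cvg_sumr => i' _; apply: cvg_sumr => j' _; apply: cvgM; last exact: cvg_entry.
by apply: cvgM; [exact: christoffel_continuous|exact: cvg_entry].
Qed.

Lemma sqaccel_in_continuous al t : atlas Q al -> I t -> dom al (c t) ->
  {for t, continuous (sqaccel_in al c)}.
Proof.
move=> aal It dt; apply: cvg_bilin; first exact: gmat_along_continuous.
all: exact: cacc_continuous.
Qed.

Lemma sqspeed_in_derive al t : atlas Q al -> I t -> dom al (c t) ->
  is_derive t 1 (sqspeed_in al c) (2 * power_in al c t).
Proof.
move=> aal It dt; have cx := codom_coord dt.
have dg := is_derive_gmat_comp (1 : R^o) aal cx (curve_differentiable cc aal It dt).
have dv : is_derive t 1 (cvel c al) ('D_1 (cvel c al) t).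
  apply: derivableP; apply: diff_derivable; exact: (cvel_differentiable cc aal It dt).
have h := is_derive_bilin dg dv dv.
apply: (is_derive_eq h).
exact: (lowered_power ('D_1 (cvel c al) t) (gmat_along_sym aal dt)
  (gmat_christoffel (cvel c al t) (cvel c al t) aal cx)).
Qed.

Lemma sqspeed_near t0 : I t0 ->
  \forall t \near t0, sqspeed c t = sqspeed_in (chart_at Q (c t0)) c t.
Proof.
move=> It0; apply: filterS (curve_near_dom oI cc It0 (chart_at_dom Q (c t0))).
move=> t [It dt]; apply: sqspeed_chart => //; try exact: chart_at_atlas.
exact: chart_at_dom.
Qed.

Lemma sqaccel_near t0 : I t0 ->
  \forall t \near t0, sqaccel c t = sqaccel_in (chart_at Q (c t0)) c t.
Proof.
move=> It0; apply: filterS (curve_near_dom oI cc It0 (chart_at_dom Q (c t0))).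
move=> t [It dt]; apply: sqaccel_chart => //; try exact: chart_at_atlas.
exact: chart_at_dom.
Qed.

Lemma sqaccel_continuous t : I t -> {for t, continuous (sqaccel c)}.
Proof.
move=> It; apply: continuous_near_eq (sqaccel_near It) _.
apply: sqaccel_in_continuous => //; first exact: chart_at_atlas.
exact: chart_at_dom.
Qed.

Lemma sqspeed_derive t : I t -> is_derive t 1 (sqspeed c) (2 * power c t).
Proof.
move=> It.
have h := sqspeed_in_derive (chart_at_atlas Q (c t)) It (chart_at_dom Q (c t)).
apply: near_eq_is_derive h; apply: filterS (sqspeed_near It) => s ->//.
Qed.

Lemma sqspeed_ge0 t : 0 <= sqspeed c t.
Proof. by apply: gmat_along_ge0; [exact: chart_at_atlas|exact: chart_at_dom]. Qed.

Lemma sqaccel_ge0 t : 0 <= sqaccel c t.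
Proof. by apply: gmat_along_ge0; [exact: chart_at_atlas|exact: chart_at_dom]. Qed.

Lemma power_le t : power c t ^+ 2 <= sqaccel c t * sqspeed c t.
Proof.
apply: bilin_CauchySchwarz => [|v].
  by apply: gmat_along_sym; [exact: chart_at_atlas|exact: chart_at_dom].
by apply: gmat_along_pos; [exact: chart_at_atlas|exact: chart_at_dom].
Qed.

End C2.
End CurveNorms.

(** * One-sided derivatives *)

Section DeriveIn.
Context {R : realType} {W : normedModType R}.
Implicit Types (f g : R -> W) (a b t : R).

Lemma diff_quot_cvg f t :
  diff_quot f t @ t^' = (fun h : R => h^-1 *: (f (h *: 1 + t) - f t)) @ 0^'.
Proof.
apply/seteqP; split => P; rewrite /fmap /= /nbhs /= /dnbhs /within /=.
- move=> /nbhs_ballP[e /= e0 H]; apply/nbhs_ballP; exists e => //= h.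
  rewrite -ball_normE /= sub0r normrN => he h0.
  have := H (h + t); rewrite /diff_quot -ball_normE /= opprD addrCA subrr addr0 normrN.
  rewrite addrK [h *: 1]mulr1; apply => //.
  by rewrite -subr_eq0 addrK.
- move=> /nbhs_ballP[e /= e0 H]; apply/nbhs_ballP; exists e => //= s.
  rewrite -ball_normE /= => he s0.
  have := H (s - t); rewrite /diff_quot -ball_normE /= sub0r opprB.
  rewrite [(s - t) *: 1]mulr1 subrK; apply => //.
  by rewrite subr_eq0.
Qed.

Lemma within_interior a b t : a < t < b -> within `[a, b]%classic t^' = t^'.
Proof.
move=> tab; have n : \forall x \near t, `[a, b]%classic x.
  have /near_in_itvoo : t \in `]a, b[ by rewrite in_itv/= tab.
  by apply: filterS => x; rewrite /= !in_itv/= => /andP[/ltW -> /ltW ->].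
apply/seteqP; split => P; last by apply: filterS => x Px _.
rewrite /within /= /dnbhs /within /= => H.
by apply: filterS2 n H => x xab h x0; exact: h.
Qed.

Lemma derive_in_interior a b f t : a < t < b -> derive_in a b f t = 'D_1 f t.
Proof.
by move=> tab; rewrite /derive_in (within_interior tab) diff_quot_cvg.
Qed.

Lemma derivable_in_interior a b f t : a < t < b ->
  derivable_in a b f t = derivable f t 1.
Proof.
by move=> tab; rewrite /derivable_in (within_interior tab) diff_quot_cvg.
Qed.

(** Limits along this filter are unique, which gives [derive_in] a determined value at the end
    points as well. *)
Lemma within_itv_proper a b t : a < b -> a <= t <= b ->
  ProperFilter (within `[a, b]%classic t^').
Proof.
move=> ab /andP[at0 tb]; apply: Build_ProperFilter_ex => P.
rewrite /within /= /dnbhs /within /= => /nbhs_ballP[e /= e0 H].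
pose d := Num.min (e / 2) ((b - a) / 2).
have d0 : 0 < d by rewrite lt_min !divr_gt0// subr_gt0.
have de : d < e by rewrite gt_min ltr_pdivrMr// ltr_pMr// ltr1n.
have dba : d <= (b - a) / 2 by rewrite ge_min lexx orbT.
(* A step towards the farther end of the interval, by at most half its length, stays inside even
   when [t] is an end point. *)
have [tm|tm] := leP t ((a + b) / 2).
- exists (t + d); apply: H.
  + by rewrite -ball_normE/= opprD addrA subrr add0r normrN gtr0_norm.
  + by rewrite -subr_eq0 addrAC subrr add0r gt_eqF.
  + by rewrite /= in_itv/=; apply/andP; split; lra.
- exists (t - d); apply: H.
  + by rewrite -ball_normE/= opprB addrCA subrr addr0 gtr0_norm.
  + by rewrite -subr_eq0 addrAC subrr add0r oppr_eq0 gt_eqF.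
  + by rewrite /= in_itv/=; apply/andP; split; lra.
Qed.

Lemma diff_quot_in_cvg a b f g t : a <= t <= b ->
  (forall s, a <= s <= b -> f s = g s) -> derivable g t 1 ->
  diff_quot f t @ within `[a, b]%classic t^' --> 'D_1 g t.
Proof.
move=> tab fg dg.
have h : diff_quot g t @ t^' --> 'D_1 g t by rewrite diff_quot_cvg.
have h2 : diff_quot g t @ within `[a, b]%classic t^' --> 'D_1 g t.
  by apply: cvg_trans h; apply: cvg_app; exact: cvg_within.
apply: cvg_trans h2; apply: near_eq_cvg.
rewrite near_withinE; near=> s => /=; rewrite in_itv/= => sab.
by rewrite /diff_quot !fg.
Unshelve. all: by end_near. Qed.

(** Converts an extension [g], as in the definition of regularity on a segment, into one-sided
    derivatives of [f] itself. *)
Lemma derive_in_ext a b f g t : a < b -> a <= t <= b ->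
  (forall s, a <= s <= b -> f s = g s) -> derivable g t 1 ->
  derivable_in a b f t /\ derive_in a b f t = 'D_1 g t.
Proof.
move=> ab tab fg dg; have h := diff_quot_in_cvg tab fg dg.
have PF := within_itv_proper ab tab.
by split; [apply/cvg_ex; exists ('D_1 g t)|exact: cvg_lim].
Qed.

(** Derivability on the larger interval matters when [t] is an end point of the smaller one: a
    one-sided derivative can exist there while the two-sided one does not. *)
Lemma derive_in_sub a b a' b' f t : a <= a' -> b' <= b -> a' < b' ->
  a' <= t <= b' -> derivable_in a b f t ->
  derive_in a' b' f t = derive_in a b f t.
Proof.
move=> aa bb ab tab df; have PF := within_itv_proper ab tab.
apply: cvg_lim => //.
have h : diff_quot f t @ within `[a, b]%classic t^' --> derive_in a b f t by exact: df.
have sub : `[a', b']%classic `<=` `[a, b]%classic.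
  move=> s; rewrite /= !in_itv/= => /andP[as0 sb].
  by rewrite (le_trans aa as0) (le_trans sb bb).
apply: cvg_trans h; apply: cvg_app => P H.
exact: (filterS (fun s Hs sab => Hs (sub s sab)) H).
Qed.

End DeriveIn.

(** * Piecewise smooth curves *)

Section Reparametrization.
Context {R : realType}.

(** Covers both translations of time ([e = 1]) and its reversal ([e = -1]). *)
Definition affine (e h : R) (t : R) : R := e * t + h.

Lemma affine_differentiable e h (t : R^o) : differentiable (affine e h : R^o -> R^o) t.
Proof.
apply: differentiableD => //; exact: differentiableM.
Qed.

Lemma affine_continuous e h (t : R^o) : {for t, continuous (affine e h : R^o -> R^o)}.
Proof. exact/differentiable_continuous/affine_differentiable. Qed.

(** Both difference quotients are the same function of the increment. The factor [e] stays in the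
    direction, which suits [class_C], where all directions are quantified over. *)
Lemma derive_affine {W : normedModType R} (f : R^o -> W) e h (v t : R^o) :
  'D_v (f \o affine e h) t = 'D_(e * v) f (affine e h t).
Proof.
apply: (congr1 (fun g : R -> W => lim (g @ (0 : R)^'))); apply/funext => k /=.
congr (_ *: (f _ - _)); rewrite /affine /GRing.scale/=; ring.
Qed.

Lemma class_C_affine {W : normedModType R} k U (f : R^o -> W) e h :
  class_C k U f -> class_C k (affine e h @^-1` U) (f \o affine e h : R^o -> W).
Proof.
elim: k f => [|k IH] f /=.
  move=> H t Ut.
  exact: (continuous_comp (affine_continuous (t := t)) (H _ Ut)).
move=> [df H]; split.
  move=> t Ut; apply: differentiable_comp; last exact: df.
  exact: affine_differentiable.
move=> v; rewrite (_ : (fun x => _) = ('D_(e * v) f) \o affine e h); first exact: IH.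
by apply/funext => t; exact: derive_affine.
Qed.

End Reparametrization.

Section PiecewiseSmooth.
Context {R : realType} {n : nat} {M : topologicalType}.
Variable Q : riemannian R n M.
Implicit Types (c : R -> M) (a b e h t : R).

Lemma curve_C_affine k I c e h : curve_C Q k I c ->
  curve_C Q k (affine e h @^-1` I) (c \o affine e h).
Proof.
move=> [cc Hc]; split.
  move=> t It; exact: (continuous_comp (affine_continuous (t := t)) (cc _ It)).
by move=> al aal; exact: (class_C_affine e h (Hc al aal)).
Qed.

Lemma smooth_curve_shift a b c h : smooth_curve Q a b c ->
  smooth_curve Q (a - h) (b - h) (c \o affine 1 h).
Proof.
move=> [e e0 [c' Hc cc']]; exists e => //; exists (c' \o affine 1 h).
  move=> k; have := curve_C_affine 1 h (Hc k).
  rewrite (_ : _ @^-1` _ = `]a - h - e, b - h + e[%classic)//.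
  apply/seteqP; split => t; rewrite /affine /= !in_itv/= => /andP[? ?]; apply/andP; split; lra.
by move=> t /andP[ta tb]; apply: cc'; rewrite /affine; apply/andP; split; lra.
Qed.

Lemma smooth_curve_flip a b c h : smooth_curve Q a b c ->
  smooth_curve Q (h - b) (h - a) (c \o affine (-1) h).
Proof.
move=> [e e0 [c' Hc cc']]; exists e => //; exists (c' \o affine (-1) h).
  move=> k; have := curve_C_affine (-1) h (Hc k).
  rewrite (_ : _ @^-1` _ = `]h - b - e, h - a + e[%classic)//.
  apply/seteqP; split => t; rewrite /affine /= !in_itv/= => /andP[? ?]; apply/andP; split; lra.
by move=> t /andP[ta tb]; apply: cc'; rewrite /affine; apply/andP; split; lra.
Qed.

Lemma smooth_curve_ext a b c c' : (forall t, a <= t <= b -> c t = c' t) ->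
  smooth_curve Q a b c -> smooth_curve Q a b c'.
Proof.
move=> cc' [e e0 [c1 Hc E]]; exists e => //; exists c1 => // t tab.
by rewrite E// cc'.
Qed.

Lemma smooth_curve_sub a b a' b' c : a <= a' -> b' <= b -> smooth_curve Q a b c ->
  smooth_curve Q a' b' c.
Proof.
move=> aa bb [e e0 [c1 Hc E]]; exists e => //; exists c1 => [k|t /andP[ta tb]]; last first.
  by apply: E; rewrite (le_trans aa ta) (le_trans tb bb).
have [h1 h2] := Hc k.
have sub : `]a' - e, b' + e[%classic `<=` `]a - e, b + e[%classic.
  by move=> t; rewrite /= !in_itv/= => /andP[? ?]; apply/andP; split; lra.
split; first by move=> t It; apply: h1; exact: sub.
move=> al aal; have := h2 al aal.
move: (coord al \o c1) => f.
have sub2 : `]a' - e, b' + e[%classic `&` c1 @^-1` dom al `<=`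
   `]a - e, b + e[%classic `&` c1 @^-1` dom al by apply: setSI.
elim: k f {h1 h2} => [|k IH] f /=; first by move=> H t /sub2; exact: H.
by move=> [d H]; split => [t /sub2|v]; [exact: d|exact: IH].
Qed.

Lemma piecewise_smooth_nil a c : piecewise_smooth Q a a c.
Proof. by exists 0%N, (fun=> a). Qed.

Lemma piecewise_smooth_rcons a x y c : piecewise_smooth Q a x c -> x < y ->
  smooth_curve Q x y c -> piecewise_smooth Q a y c.
Proof.
move=> [m [tau [t0 tm H]]] xy sc.
exists m.+1, (fun i => if (i <= m)%N then tau i else y); split.
- by rewrite leq0n.
- by rewrite ltnn.
- move=> i; rewrite ltnS => im; rewrite im; case: ltnP => [im'|mi].
    exact: H.
  by have -> : i = m; [apply/eqP; rewrite eqn_leq im mi|rewrite tm].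
Qed.

(** Hides the subdivision: a property of [[a, x]] has only to survive the addition of one smooth
    piece [[x, y]]. *)
Lemma piecewise_smooth_ind (P : R -> Prop) a b c : piecewise_smooth Q a b c ->
  P a ->
  (forall x y, a <= x -> x < y -> y <= b -> smooth_curve Q x y c -> P x -> P y) ->
  P b.
Proof.
move=> [m [tau [t0 tm H]]] Pa step.
have mono i j : (i <= j <= m)%N -> tau i <= tau j.
  move=> /andP[]; elim: j => [|j IH]; first by rewrite leqn0 => /eqP ->.
  rewrite leq_eqVlt => /predU1P[->//|]; rewrite ltnS => ij jm.
  by apply: le_trans (IH ij (ltnW jm)) _; have [/ltW] := H j jm.
have : forall i, (i <= m)%N -> P (tau i).
  elim=> [|i IH] im; first by rewrite t0.
  have [lt sc] := H i im.
  apply: (step (tau i)) => //; last exact: (IH (ltnW im)).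
    by rewrite -t0; apply: mono; rewrite leq0n ltnW.
  by rewrite -tm; apply: mono; rewrite im leqnn.
by move=> /(_ m (leqnn m)); rewrite tm.
Qed.

Lemma piecewise_smooth_sub a b a' b' c : piecewise_smooth Q a b c ->
  a <= a' -> a' <= b' -> b' <= b -> piecewise_smooth Q a' b' c.
Proof.
move=> pw aa ab bb; move: b' bb ab.
(* The right end is generalized, because the last piece [[x, y]] may contain [b'], or both [a'] and
   [b'], in its interior. *)
apply: (piecewise_smooth_ind pw (P := fun x => forall b', b' <= x -> a' <= b' ->
  piecewise_smooth Q a' b' c)).
  move=> b' ba ab; suff -> : b' = a' by exact: piecewise_smooth_nil.
  by apply/eqP; rewrite eq_le ab (le_trans ba aa).
move=> x y ax xy yb sc IH b' by' ab.
have [bx|xb] := leP b' x; first exact: IH.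
have [ax'|xa] := leP a' x.
  apply: (piecewise_smooth_rcons _ xb); first exact: IH.
  exact: smooth_curve_sub sc.
have [->|ne] := eqVneq a' b'; first exact: piecewise_smooth_nil.
apply: (piecewise_smooth_rcons (piecewise_smooth_nil _ _)).
  by rewrite lt_neqAle ne.
by apply: smooth_curve_sub sc => //; exact: ltW.
Qed.

Lemma piecewise_smooth_cat a b d c : piecewise_smooth Q a b c ->
  piecewise_smooth Q b d c -> piecewise_smooth Q a d c.
Proof.
move=> pw1 pw2; apply: (piecewise_smooth_ind pw2 (P := fun x => piecewise_smooth Q a x c)) => //.
by move=> x y _ xy _ sc pw; exact: piecewise_smooth_rcons sc.
Qed.

Lemma piecewise_smooth_ext a b c c' : (forall t, a <= t <= b -> c t = c' t) ->
  piecewise_smooth Q a b c -> piecewise_smooth Q a b c'.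
Proof.
move=> cc' pw; apply: (piecewise_smooth_ind pw (P := fun x => piecewise_smooth Q a x c')).
  exact: piecewise_smooth_nil.
move=> x y ax xy yb sc pw'; apply: (piecewise_smooth_rcons pw' xy).
apply: smooth_curve_ext sc => t /andP[xt ty]; apply: cc'.
by rewrite (le_trans ax xt) (le_trans ty yb).
Qed.

Lemma piecewise_smooth_shift a b c h : piecewise_smooth Q a b c ->
  piecewise_smooth Q (a - h) (b - h) (c \o affine 1 h).
Proof.
move=> pw; apply: (piecewise_smooth_ind pw
  (P := fun x => piecewise_smooth Q (a - h) (x - h) (c \o affine 1 h))).
  exact: piecewise_smooth_nil.
move=> x y _ xy _ sc pw'; apply: (piecewise_smooth_rcons pw').
  by rewrite ltrD2r.
exact: smooth_curve_shift.
Qed.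

Lemma piecewise_smooth_flip a b c h : piecewise_smooth Q a b c ->
  piecewise_smooth Q (h - b) (h - a) (c \o affine (-1) h).
Proof.
move=> pw; apply: (piecewise_smooth_ind pw
  (P := fun x => piecewise_smooth Q (h - x) (h - a) (c \o affine (-1) h))).
  exact: piecewise_smooth_nil.
(* After reversal the new piece comes first, so it is put in front of the others by
   concatenation. *)
move=> x y _ xy _ sc pw'; apply: piecewise_smooth_cat pw'.
apply: (piecewise_smooth_rcons (piecewise_smooth_nil _ _)).
  by rewrite ltrD2l ltrN2.
exact: smooth_curve_flip.
Qed.

End PiecewiseSmooth.

(** * Length and distance *)

Section LowerIntegral.
Local Open Scope ereal_scope.
Import HBNNSimple.

(* The integral of a non-negative function is a supremum over simple functions,
   so that no measurability is needed here and below; curve lengths and actions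
   can thus be compared without knowing that speeds are measurable. *)
Lemma ge0_subset_le_integral d (T : measurableType d) (R : realType)
    (mu : {measure set T -> \bar R}) (D1 D2 : set T) (f1 f2 : T -> \bar R) :
  (forall x, D1 x -> 0 <= f1 x) -> (forall x, D2 x -> 0 <= f2 x) ->
  (forall x, D1 x -> D2 x /\ f1 x <= f2 x) ->
  \int[mu]_(x in D1) f1 x <= \int[mu]_(x in D2) f2 x.
Proof.
move=> f10 f20 H; rewrite !ge0_integralE//.
apply: ge_ereal_sup => _ [h hf <-]; apply: ereal_sup_ubound; exists h => // x /=.
apply: le_trans (hf x) _; rewrite !patchE.
have [xD1|_] := boolP (x \in D1).
  by have [xD2 le12] := H x (set_mem xD1); rewrite mem_set.
by case: ifPn => // xD2; apply: f20; exact: set_mem.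
Qed.

Lemma ge0_integral_le_nnsfun d (T : measurableType d) (R : realType)
    (mu : {measure set T -> \bar R}) (D : set T) (f : T -> \bar R) (C : \bar R) :
  measurable D -> (forall x, D x -> 0 <= f x) ->
  (forall h : {nnsfun T >-> R}, (forall x, D x -> (h x)%:E <= f x) ->
     \int[mu]_(x in D) (h x)%:E <= C) ->
  \int[mu]_(x in D) f x <= C.
Proof.
move=> mD f0 H; rewrite ge0_integralE//.
apply: ge_ereal_sup => _ [h /= hf <-].
have hD x : D x -> (h x)%:E <= f x.
  by move=> Dx; apply: le_trans (hf x) _; rewrite patchE mem_set.
apply: le_trans (H h hD); rewrite -integralT_nnsfun integral_mkcond [leRHS]integral_mkcond.
apply: ge0_subset_le_integral => [x _|x _|x _]; rewrite patchE ?in_setT.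
- by rewrite lee_fin.
- by case: ifP => // _; rewrite lee_fin.
- split => //; rewrite patchE; have [//|xD] := boolP (x \in D).
  by move: (hf x); rewrite patchE (negbTE xD).
Qed.

(** The comparisons are asked for in the open pieces only: the end points are null, and a speed or
    an acceleration may take an unrelated value there. *)
Lemma ge0_integral_itv_split_le (R : realType) (x y z : R) (f g1 g2 : R -> R) :
  (x <= y <= z)%R -> (forall t, x <= t <= z -> 0 <= f t)%R ->
  (forall t, x <= t <= y -> 0 <= g1 t)%R -> (forall t, y <= t <= z -> 0 <= g2 t)%R ->
  (forall t, x < t < y -> f t <= g1 t)%R -> (forall t, y < t < z -> f t <= g2 t)%R ->
  \int[lebesgue_measure]_(t in `[x, z]) (f t)%:E <=
  \int[lebesgue_measure]_(t in `[x, y]) (g1 t)%:E +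
  \int[lebesgue_measure]_(t in `[y, z]) (g2 t)%:E.
Proof.
move=> /andP[xy yz] f0 g10 g20 fg1 fg2.
apply: ge0_integral_le_nnsfun => // h hf.
have mh (A : set (measurableTypeR R)) : measurable_fun A (EFin \o h).
  by apply/measurable_EFinP; exact: measurable_funTS.
have E : `[x, z]%classic = `[x, y]%classic `|` `]y, z]%classic.
  by rewrite -itv_bndbnd_setU// bnd_simp.
rewrite E ge0_integral_setU//=; last 2 first.
- by move=> t _; rewrite lee_fin.
- rewrite disj_set2E; apply/eqP/seteqP; split => // t [] /=.
  by rewrite !in_itv/= => /andP[_ ty] /andP[+ _]; rewrite ltNge ty.
apply: leeD; (rewrite integral_itv_bndoo; last exact: mh).
- apply: ge0_subset_le_integral => [t _|t|t]; rewrite /= ?in_itv/= ?lee_fin//.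
    exact: g10.
  move=> /andP[xt ty]; split; first by rewrite !ltW.
  rewrite -lee_fin; apply: le_trans (hf t _) _.
    by rewrite /= in_itv/= (ltW xt) (le_trans (ltW ty) yz).
  by rewrite lee_fin; apply: fg1; rewrite xt.
- apply: ge0_subset_le_integral => [t _|t|t]; rewrite /= ?in_itv/= ?lee_fin//.
    exact: g20.
  move=> /andP[xt ty]; split; first by rewrite !ltW.
  rewrite -lee_fin; apply: le_trans (hf t _) _.
    by rewrite /= in_itv/= (ltW ty) (le_trans xy (ltW xt)).
  by rewrite lee_fin; apply: fg2; rewrite xt.
Qed.

Lemma integral_itv_cst (R : realType) (x y k : R) : (x <= y)%R ->
  \int[lebesgue_measure]_(t in `[x, y]) k%:E = (k * (y - x))%:E.
Proof.
move=> xy; rewrite integral_cst//= lebesgue_measure_itv/= lte_fin.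
have [_|yx] := ltP x y; first by rewrite EFinN EFinM EFinB.
have -> : y = x by apply/eqP; rewrite eq_le xy yx.
by rewrite subrr mulr0 mule0.
Qed.

End LowerIntegral.

Section Distance.
Context {R : realType} {n : nat} {M : topologicalType}.
Variable Q : riemannian R n M.
Implicit Types (c w : R -> M) (a b t K : R) (al : chart R n M).

Lemma gnorm_ge0 p v : 0 <= gnorm Q p v.
Proof. exact: sqrtr_ge0. Qed.

Lemma velocity_near a b a' b' c c' al t : a < t < b -> a' < t < b' ->
  (\forall s \near t, c s = c' s) -> velocity a b c al t = velocity a' b' c' al t.
Proof.
move=> tab tab' cc; rewrite /velocity (derive_in_interior _ tab) (derive_in_interior _ tab').
by apply: near_eq_derive; apply: filterS cc => s /= ->.
Qed.

Lemma speed_near a b a' b' c c' t : a < t < b -> a' < t < b' ->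
  (\forall s \near t, c s = c' s) -> speed Q a b c t = speed Q a' b' c' t.
Proof.
move=> tab tab' cc; rewrite /speed -(nbhs_singleton cc); congr (gnorm Q _ _).
by apply/funext => al; exact: velocity_near.
Qed.

Lemma velocity_shift a b c h al t : a < t + h < b ->
  velocity (a - h) (b - h) (c \o affine 1 h) al t = velocity a b c al (t + h).
Proof.
move=> tab; have tab' : a - h < t < b - h.
  by case/andP: tab => ? ?; apply/andP; split; lra.
rewrite /velocity (derive_in_interior _ tab) (derive_in_interior _ tab').
have := derive_affine (coord al \o c : R^o -> 'rV[R]_n) 1 h 1 t.
by rewrite mul1r {2}/affine mul1r => <-.
Qed.

Lemma speed_shift a b c h t : a < t + h < b ->
  speed Q (a - h) (b - h) (c \o affine 1 h) t = speed Q a b c (t + h).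
Proof.
move=> tab; rewrite /speed /= {1}/affine mul1r; congr (gnorm Q _ _).
by apply/funext => al; exact: velocity_shift.
Qed.

Definition glue b c w : R -> M := fun t => if t <= b then c t else w t.

Lemma near_lt a t : a < t -> \forall s \near t, a < s.
Proof. by move=> at0; near=> s; near: s; exact: lt_nbhsr. Unshelve. all: by end_near. Qed.

Lemma near_gt a t : t < a -> \forall s \near t, s < a.
Proof. by move=> at0; near=> s; near: s; exact: lt_nbhsl. Unshelve. all: by end_near. Qed.

Lemma piecewise_smooth_glue a b d c w : piecewise_smooth Q a b c ->
  piecewise_smooth Q b d w -> c b = w b -> piecewise_smooth Q a d (glue b c w).
Proof.
move=> pc pw cw; apply: (@piecewise_smooth_cat _ _ _ _ a b).
  by apply: piecewise_smooth_ext pc => t /andP[_ tb]; rewrite /glue tb.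
apply: piecewise_smooth_ext pw => t /andP[bt _]; rewrite /glue.
case: ifP => // tb; have -> : t = b by apply/eqP; rewrite eq_le tb bt.
by rewrite cw.
Qed.

Lemma speed_glue_l a b d c w t : b <= d -> a < t < b ->
  speed Q a d (glue b c w) t = speed Q a b c t.
Proof.
move=> bd /andP[at0 tb]; apply: speed_near; rewrite ?at0 ?tb ?(lt_le_trans tb bd)//.
by apply: filterS (near_gt tb) => s sb; rewrite /glue ltW.
Qed.

Lemma speed_glue_r a b d c w t : a <= b -> b < t < d ->
  speed Q a d (glue b c w) t = speed Q b d w t.
Proof.
move=> bd /andP[at0 tb]; apply: speed_near; rewrite ?at0 ?tb ?(le_lt_trans bd at0)//.
by apply: filterS (near_lt at0) => s sb; rewrite /glue leNgt sb.
Qed.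

Lemma curve_length_glue_le a b d c w : a <= b <= d ->
  (curve_length Q a d (glue b c w) <=
   curve_length Q a b c + curve_length Q b d w)%E.
Proof.
move=> abd; have /andP[ab bd] := abd.
apply: (ge0_integral_itv_split_le abd) => [t _|t _|t _|t tt|t tt].
- exact: gnorm_ge0.
- exact: gnorm_ge0.
- exact: gnorm_ge0.
- by rewrite (speed_glue_l _ _ bd tt).
- by rewrite (speed_glue_r _ _ ab tt).
Qed.

Lemma curve_length_le a b c K : a <= b -> 0 <= K ->
  (forall t, a < t < b -> speed Q a b c t <= K) ->
  (curve_length Q a b c <= (K * (b - a))%:E)%E.
Proof.
move=> ab K0 H; rewrite -integral_itv_cst//.
have := @ge0_integral_itv_split_le R a a b (speed Q a b c) (fun=> K) (fun=> K).
rewrite integral_itv_cst// subrr mulr0 add0e; apply => //.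
- by rewrite lexx.
- by move=> t _; exact: gnorm_ge0.
- by move=> t /andP[/lt_trans h /h]; rewrite ltxx.
Qed.

(* Attaching [w] to an almost minimal path replaces the triangle inequality:
   only the path of bounded speed is reparametrized, so that no change of
   variables in a length is needed. *)
Lemma dist_append p w a b K : a < b -> piecewise_smooth Q a b w -> 0 <= K ->
  (forall t, a < t < b -> speed Q a b w t <= K) ->
  (dist Q p (w b) <= dist Q p (w a) + (K * (b - a))%:E)%E.
Proof.
move=> ab pw K0 H; rewrite -leeBlDr//.
apply: le_ereal_inf_tmp => _ [x [y [g [xy pg gx gy ->]]]].
(* Translation by [h] makes [w] start at time [y], where the path [g] ends. *)
rewrite leeBlDr//; pose h := a - y.
have pw' := piecewise_smooth_shift h pw.
have E1 : a - h = y by rewrite /h; ring.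
rewrite E1 in pw'.
have yb : y < b - h by rewrite /h; lra.
apply: (@le_trans _ _ (curve_length Q x (b - h) (glue y g (w \o affine 1 h)))).
  apply: ereal_inf_lbound; exists x, (b - h), (glue y g (w \o affine 1 h)); split => //.
  - exact: lt_trans yb.
  - apply: piecewise_smooth_glue => //; rewrite gy /= /affine; congr w; rewrite /h; ring.
  - by rewrite /glue (ltW xy).
  - rewrite /glue leNgt yb /= /affine; congr w; ring.
apply: le_trans (curve_length_glue_le _ _ _) _; first by rewrite !ltW.
apply: leeD; first exact: lexx.
have -> : b - a = (b - h) - y by rewrite /h; ring.
apply: curve_length_le => //; first exact: ltW.
move=> t /andP[yt tb]; rewrite -[y in speed _ y]E1.
have tab : a < t + h < b by apply/andP; split; rewrite /h in tb *; lra.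
by rewrite speed_shift// H.
Qed.

(** The mirror image of [dist_append]. Deducing it by symmetry of [dist] would require reversing an
    arbitrary path; here again only [w] is moved in time. *)
Lemma dist_prepend p w a b K : a < b -> piecewise_smooth Q a b w -> 0 <= K ->
  (forall t, a < t < b -> speed Q a b w t <= K) ->
  (dist Q (w a) p <= dist Q (w b) p + (K * (b - a))%:E)%E.
Proof.
move=> ab pw K0 H; rewrite -leeBlDr//.
apply: le_ereal_inf_tmp => _ [x [y [g [xy pg gx gy ->]]]].
rewrite leeBlDr//; pose h := b - x.
have pw' := piecewise_smooth_shift h pw.
have E1 : b - h = x by rewrite /h; ring.
rewrite E1 in pw'.
have yb : a - h < x by rewrite /h; lra.
apply: (@le_trans _ _ (curve_length Q (a - h) y (glue x (w \o affine 1 h) g))).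
  apply: ereal_inf_lbound; exists (a - h), y, (glue x (w \o affine 1 h) g); split => //.
  - exact: lt_trans xy.
  - apply: piecewise_smooth_glue => //; rewrite gx /= /affine; congr w; rewrite /h; ring.
  - rewrite /glue (ltW yb) /= /affine; congr w; ring.
  - by rewrite /glue leNgt xy.
apply: le_trans (curve_length_glue_le _ _ _) _; first by rewrite !ltW.
rewrite [leRHS]addeC; apply: leeD; last exact: lexx.
have -> : b - a = x - (a - h) by rewrite /h; ring.
apply: curve_length_le => //; first exact: ltW.
move=> t /andP[yt tb]; rewrite -[X in speed _ _ X]E1.
have tab : a < t + h < b by apply/andP; split; rewrite /h in yt tb *; lra.
by rewrite speed_shift// H.
Qed.

End Distance.

(** * Speed and acceleration on a smooth piece *)

Section Pieces.
Context {R : realType} {n : nat} {M : topologicalType}.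
Variable Q : riemannian R n M.
Implicit Types (c : R -> M) (t x y : R) (al : chart R n M).

Section OnSegment.
Variables (a b : R) (c : R -> M).
Hypotheses (ab : a < b) (c1 : C1_curve Q a b c).

Lemma C1_curve_derivable_in al t : atlas Q al -> a <= t <= b -> dom al (c t) ->
  derivable_in a b (coord al \o c) t.
Proof.
move=> aal tab dt; case: c1 => e e0 [c' [_ Hc'] cc'].
have d : differentiable (coord al \o c' : R^o -> 'rV[R]_n) t.
  have [+ _] := Hc' al aal; apply; split.
    by rewrite /= in_itv/=; case/andP: tab => ? ?; apply/andP; split; lra.
  by rewrite /= cc'.
have h s : a <= s <= b -> (coord al \o c) s = (coord al \o c') s.
  by move=> sab; rewrite /= cc'.
by have [] := derive_in_ext ab tab h (diff_derivable d).
Qed.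

(** Class C^1 makes the one-sided velocity of a piece at a break point equal to the velocity of the
    whole curve. *)
Lemma speed_sub a' b' t : a <= a' -> b' <= b -> a' < b' -> a' <= t <= b' ->
  speed Q a' b' c t = speed Q a b c t.
Proof.
move=> aa bb ab' tab.
rewrite /speed /gnorm /velocity (derive_in_sub aa bb ab' tab)//.
apply: C1_curve_derivable_in; [exact: chart_at_atlas| |exact: chart_at_dom].
by case/andP: tab => ? ?; rewrite (le_trans aa)//= (le_trans _ bb).
Qed.

Lemma speed_flip a' b' h t : a <= a' -> b' <= b -> a' < h - t < b' ->
  speed Q (h - b') (h - a') (c \o affine (-1) h) t = speed Q a' b' c (h - t).
Proof.
move=> aa bb tab.
have tab' : h - b' < t < h - a' by case/andP: tab => ? ?; apply/andP; split; lra.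
have tab'' : a < h - t < b.
  by case/andP: tab => ? ?; rewrite (le_lt_trans aa)//= (lt_le_trans _ bb).
have E : affine (-1) h t = h - t by rewrite /affine; ring.
rewrite /speed /gnorm /velocity /= E.
set al := chart_at Q _.
have d : derivable (coord al \o c) (h - t) 1.
  rewrite -(derivable_in_interior _ tab''); apply: C1_curve_derivable_in.
  - exact: chart_at_atlas.
  - by case/andP: tab'' => /ltW -> /ltW ->.
  - exact: chart_at_dom.
rewrite (derive_in_interior _ tab) (derive_in_interior _ tab').
(* Linearity of the differential turns the direction -1 into a sign, which the norm ignores. *)
have -> : 'D_1 (coord al \o (c \o affine (-1) h)) t = - 'D_1 (coord al \o c) (h - t).
  have := derive_affine (coord al \o c : R^o -> 'rV[R]_n) (-1) h 1 t.
  rewrite E => ->.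
  move/derivable1_diffP : d => d.
  by rewrite !deriveE// mulr1 linearN.
by rewrite bilinNN.
Qed.

End OnSegment.

Lemma velocity_piece a b c c' x y al t : a <= x -> y <= b -> x < t < y ->
  (forall s, x <= s <= y -> c s = c' s) ->
  velocity a b c al t = cvel c' al t.
Proof.
move=> ax yb /andP[xt ty] cc; rewrite /velocity derive_in_interior; last first.
  by rewrite (le_lt_trans ax xt) (lt_le_trans ty yb).
apply: near_eq_derive.
apply: filterS2 (near_lt xt) (near_gt ty) => s /ltW xs /ltW sy /=.
by rewrite cc// xs sy.
Qed.

Lemma velocity_piece_near a b c c' x y al t : a <= x -> y <= b -> x < t < y ->
  (forall s, x <= s <= y -> c s = c' s) ->
  \forall s \near t, velocity a b c al s = cvel c' al s.
Proof.
move=> ax yb /andP[xt ty] cc.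
apply: filterS2 (near_lt xt) (near_gt ty) => s xs sy.
by apply: (velocity_piece _ ax yb) cc; rewrite xs sy.
Qed.

Lemma covariant_piece a b c c' x y al t : a <= x -> y <= b -> x < t < y ->
  (forall s, x <= s <= y -> c s = c' s) ->
  derivable (cvel c' al) t 1 ->
  covariant Q a b c (velocity a b c) al t = cacc Q c' al t.
Proof.
move=> ax yb xty cc d; have /andP[xt ty] := xty.
have ct : c t = c' t by rewrite cc// (ltW xt) (ltW ty).
apply/rowP => k; rewrite !mxE.
rewrite derive_in_interior; last by rewrite (le_lt_trans ax xt) (lt_le_trans ty yb).
rewrite (near_eq_derive _ (velocity_piece_near al ax yb xty cc)).
by rewrite (velocity_piece al ax yb xty cc) ct.
Qed.

(** On a smooth piece, speed and acceleration are those of a C^2 extension. The speeds agree up to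
    the end points because the whole curve is C^1; the accelerations agree inside only, since the
    velocity may fail to be derivable at a break point. *)
Lemma smooth_piece a b c x y : a <= x -> x < y -> y <= b ->
  C1_curve Q a b c -> smooth_curve Q x y c ->
  exists (e : R) (c' : R -> M),
    [/\ 0 < e, curve_C Q 2 `]x - e, y + e[%classic c',
        forall t, x <= t <= y -> speed Q a b c t ^+ 2 = sqspeed Q c' t &
        forall t, x < t < y -> has_accel Q a b c t /\
          accel_norm Q a b c t ^+ 2 = sqaccel Q c' t].
Proof.
move=> ax xy yb c1 [e e0 [c' /(_ 2) cc' E]].
have ab : a < b by exact: le_lt_trans ax (lt_le_trans xy yb).
have EE s : x <= s <= y -> c s = c' s by move=> /E ->.
have inI t : x <= t <= y -> `]x - e, y + e[%classic t.
  by rewrite /= in_itv/= => /andP[? ?]; apply/andP; split; lra.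
exists e, c'; split => // t xty.
- have d : differentiable (coord (chart_at Q (c' t)) \o c' : R^o -> 'rV[R]_n) t.
    apply: (curve_differentiable cc'); [exact: chart_at_atlas|exact: inI|].
    exact: chart_at_dom.
  rewrite -(speed_sub ab c1 ax yb xy xty) /speed /gnorm /velocity (EE _ xty).
  have h s : x <= s <= y ->
    (coord (chart_at Q (c' t)) \o c) s = (coord (chart_at Q (c' t)) \o c') s.
    by move=> xsy /=; rewrite EE.
  have [_ ->] := derive_in_ext xy xty h (diff_derivable d).
  by rewrite sqr_sqrtr//; exact: sqspeed_ge0.
- have xty' : x <= t <= y by case/andP: xty => /ltW -> /ltW ->.
  have tab : a < t < b.
    by case/andP: xty => xt ty; rewrite (le_lt_trans ax xt) (lt_le_trans ty yb).
  have d : derivable (cvel c' (chart_at Q (c' t))) t 1.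
    apply: diff_derivable; apply: (cvel_differentiable cc'); first exact: chart_at_atlas.
      exact: inI.
    exact: chart_at_dom.
  split.
    rewrite /has_accel (EE _ xty') (derivable_in_interior _ tab).
    apply: near_eq_derivable d; apply: filterS (velocity_piece_near (chart_at Q (c' t)) ax yb xty EE).
    by move=> s ->.
  rewrite /accel_norm /gnorm (EE _ xty') (covariant_piece ax yb xty EE d).
  by rewrite sqr_sqrtr//; exact: sqaccel_ge0.
Qed.

End Pieces.

(** * Boundedness of the acceleration and growth of the speed *)

Section Bounds.
Context {R : realType} {n : nat} {M : topologicalType}.
Variable Q : riemannian R n M.
Implicit Types (c : R -> M) (t x y : R).

Lemma accel_norm_bounded a b c : a < b -> C1_curve Q a b c ->
  piecewise_smooth Q a b c ->
  exists K, forall t, a <= t <= b -> accel_norm Q a b c t <= K.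
Proof.
move=> ab c1 pw.
apply: (piecewise_smooth_ind pw (P := fun x => exists K, forall t, a <= t <= x ->
  accel_norm Q a b c t <= K)).
  by exists (accel_norm Q a b c a) => t /le_anti <-.
move=> x y ax xy yb sc [K HK].
have [e [c' [e0 cc' _ acc]]] := smooth_piece ax xy yb c1 sc.
have cont : {within `[x, y], continuous (sqaccel Q c' : R -> R)}.
  apply: continuous_in_subspaceT => t; rewrite inE/= in_itv/= => xty.
  apply: (sqaccel_continuous (interval_open _ _) cc') => //.
  by rewrite /= in_itv/=; case/andP: xty => ? ?; apply/andP; split; lra.
have [z _ zmax] := EVT_max (ltW xy) cont.
have K0 : 0 <= K.
  by apply: le_trans (HK a _); [exact: gnorm_ge0|rewrite lexx].
(* The maximum over the piece comes from the extension, which is continuous on the closed interval.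
   The value at the possible break point [y] is not controlled by it and is added separately. A
   bound on the square suffices through [w <= 1 + w ^+ 2]. *)
have bnd : exists B, [/\ K <= B, accel_norm Q a b c y <= B &
    forall u : R, u ^+ 2 <= sqaccel Q c' z -> u <= B].
  have m0 : 0 <= sqaccel Q c' z by exact: sqaccel_ge0.
  have ay : 0 <= accel_norm Q a b c y by exact: gnorm_ge0.
  move: (sqaccel Q c' z : R) (accel_norm Q a b c y) m0 ay => m u m0 u0.
  exists (K + (1 + m) + u); split; [lra|lra|move=> w wm].
  have : w <= 1 + w ^+ 2 by nra.
  by lra.
have [B [KB yB mB]] := bnd.
exists B => t /andP[at0 ty].
have [tx|xt] := leP t x.
  by apply: le_trans KB; apply: HK; rewrite at0.
move: ty; rewrite le_eqVlt => /predU1P[->//|ty].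
have [|_ at2] := acc t; first by rewrite xt.
by apply: mB; rewrite at2; apply: zmax; rewrite in_itv/= !ltW.
Qed.

Lemma accel_norm_le_max_accel T c t : 0 < T -> C1_curve Q 0 T c ->
  piecewise_smooth Q 0 T c -> 0 <= t <= T -> has_accel Q 0 T c t ->
  accel_norm Q 0 T c t <= max_accel Q T c.
Proof.
move=> T0 c1 pw tT ha; have [K HK] := accel_norm_bounded T0 c1 pw.
apply: sup_upper_bound; last by exists t.
split; first by exists (accel_norm Q 0 T c t), t.
by exists K => _ [u [uT _ ->]]; exact: HK.
Qed.

Lemma piecewise_integral_le a b c (f : R -> R) K : piecewise_smooth Q a b c ->
  (forall t, a <= t <= b -> 0 <= f t) -> 0 <= K ->
  (forall x y, a <= x -> x < y -> y <= b -> smooth_curve Q x y c ->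
     forall t, x < t < y -> f t <= K) ->
  (\int[lebesgue_measure]_(t in `[a, b]) (f t)%:E <= (K * (b - a))%:E)%E.
Proof.
move=> pw f0 K0 H; apply: (piecewise_smooth_ind pw (P := fun x =>
  (\int[lebesgue_measure]_(t in `[a, x]) (f t)%:E <= (K * (x - a))%:E)%E)).
  by rewrite set_itv1 integral_set1 subrr mulr0.
move=> x y ax xy yb sc IH.
have fx t : a <= t <= y -> 0 <= f t.
  by move=> /andP[at0 ty]; apply: f0; rewrite at0 (le_trans ty yb).
apply: (@le_trans _ _ (\int[lebesgue_measure]_(t in `[a, x]) (f t)%:E +
   \int[lebesgue_measure]_(t in `[x, y]) K%:E)%E).
  apply: (@ge0_integral_itv_split_le R a x y f f (fun=> K)) => //.
  - by rewrite ax ltW.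
  - by move=> t /andP[at0 tx]; apply: fx; rewrite at0 (le_trans tx (ltW xy)).
  - exact: H sc.
rewrite integral_itv_cst ?(ltW xy)//.
have -> : K * (y - a) = K * (x - a) + K * (y - x) by ring.
by rewrite EFinD; apply: leeD.
Qed.

(** Here [a2] and [s2] are the squared norms of acceleration and velocity, and [p] is their inner
    product, so the left-hand side is the derivative of the regularized speed. The last step is
    Young's inequality, from the square of [l * r - 1]. *)
Lemma power_le_accel (p a2 s2 C l : R) : 0 <= a2 -> 0 <= s2 -> 0 < C -> 0 < l ->
  p ^+ 2 <= a2 * s2 ->
  p / Num.sqrt (s2 + C) <= l / 2 * a2 + (2 * l)^-1.
Proof.
move=> a0 s0 C0 l0 h.
have k0 : 0 < Num.sqrt (s2 + C) by rewrite sqrtr_gt0; lra.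
have k2 : Num.sqrt (s2 + C) ^+ 2 = s2 + C by rewrite sqr_sqrtr//; lra.
rewrite ler_pdivrMr//.
move: (Num.sqrt (s2 + C)) k0 k2 => k k0 k2.
have r0 : 0 <= Num.sqrt a2 by exact: sqrtr_ge0.
have r2 : Num.sqrt a2 ^+ 2 = a2 by rewrite sqr_sqrtr.
move: (Num.sqrt a2) r0 r2 => r r0 r2.
have prk : p <= r * k.
  rewrite real_leNgt ?num_real//; apply/negP => lt.
  have : (r * k) ^+ 2 < p ^+ 2.
    by rewrite ltr_pXn2r// ?nnegrE ?mulr_ge0 ?(ltW k0)//; apply: le_trans (ltW lt); rewrite mulr_ge0// ltW.
  rewrite exprMn r2 k2 ltNge => /negP; apply.
  by apply: le_trans h _; rewrite ler_wpM2l//; lra.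
apply: le_trans prk _; rewrite ler_wpM2r ?(ltW k0)// -r2.
have -> : l / 2 * r ^+ 2 + (2 * l)^-1 = ((l * r) ^+ 2 + 1) / (2 * l).
  by field; rewrite gt_eqF.
rewrite ler_pdivlMr; last by lra.
have := sqr_ge0 (l * r - 1); lra.
Qed.

(** [F - k] is nondecreasing, where [F] is the integral of [phi]. The fundamental theorem is applied
    to the continuous [phi] alone, and [k] enters through its derivative at each point. *)
Lemma smooth_speed_growth (I : set R) c x y (C l : R) : open I -> curve_C Q 2 I c ->
  x < y -> (forall t, x <= t <= y -> I t) -> 0 < C -> 0 < l ->
  ((Num.sqrt (sqspeed Q c y + C) - Num.sqrt (sqspeed Q c x + C))%:E <=
   \int[lebesgue_measure]_(t in `[x, y]) (l / 2 * sqaccel Q c t + (2 * l)^-1)%:E)%E.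
Proof.
move=> oI cc xy sI C0 l0.
pose k (t : R) : R := Num.sqrt (sqspeed Q c t + C).
pose phi (t : R) : R := l / 2 * sqaccel Q c t + (2 * l)^-1.
have kd t : x <= t <= y -> is_derive t 1 k (power Q c t / k t).
  move=> /sI It; have d := sqspeed_derive oI cc It.
  have s0 := sqspeed_ge0 Q c t.
  have d1 : is_derive (t : R^o) 1 (fun s => sqspeed Q c s + C : R^o) (2 * power Q c t).
    by rewrite -[X in is_derive _ _ _ X]addr0; apply: is_deriveD.
  have p0 : 0 < sqspeed Q c t + C by lra.
  have d2 := is_derive1_sqrt p0.
  have [dk E] := @is_derive1_comp R Num.sqrt (fun s => sqspeed Q c s + C) t _ _ d2 d1.
  split => //; rewrite E /k.
  by field; rewrite sqrtr_eq0 -ltNge.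
have cphi t : x <= t <= y -> {for t, continuous phi}.
  move=> /sI It; apply: cvgD; last exact: cvg_cst.
  apply: cvgM; first exact: cvg_cst.
  exact: (sqaccel_continuous oI cc It).
have wphi : {within `[x, y], continuous phi}.
  by apply: continuous_in_subspaceT => t; rewrite inE/= in_itv/=; exact: cphi.
have wk : {within `[x, y], continuous k}.
  by apply: derivable_within_continuous => t; rewrite in_itv/= => /kd[].
have iphi : lebesgue_measure.-integrable `[x, y] (EFin \o phi).
  by apply: continuous_compact_integrable => //; exact: segment_compact.
pose F t := (\int[lebesgue_measure]_(s in `[x, t]) phi s)%R.
have wF : {within `[x, y], continuous F}.
  exact: (parameterized_integral_continuous (ltW xy) iphi).
have dF t : x < t < y -> derivable F t 1 /\ F^`()%classic t = phi t.
  move=> /andP[xt ty]; apply: (continuous_FTC1_closed ty iphi) => //.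
  by apply: cphi; rewrite !ltW.
have dD t : x < t < y -> is_derive t 1 (F - k) (phi t - power Q c t / k t).
  move=> xty; have [d E] := dF t xty; apply: is_deriveB.
    by split; [exact: d|rewrite -derive1E; exact: E].
  by apply: kd; case/andP: xty => /ltW -> /ltW ->.
have D0 t : t \in `]x, y[ -> 0 <= (F - k)^`()%classic t.
  rewrite in_itv/= => xty; have [_ E] := dD t xty; rewrite derive1E E subr_ge0.
  apply: power_le_accel => //; [exact: sqaccel_ge0|exact: sqspeed_ge0|].
  exact: power_le.
have dDi t : t \in `]x, y[ -> derivable (F - k) t 1.
  by rewrite in_itv/= => /dD[].
have cD : {within `[x, y], continuous (F - k)}.
  by move=> t; apply: continuousB; [exact: wF|exact: wk].
have xI : x \in `[x, y] by rewrite in_itv/= lexx ltW.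
have yI : y \in `[x, y] by rewrite in_itv/= lexx ltW.
have : F x - k x <= F y - k y.
  exact: (ger0_derive1_le_cc dDi D0 cD xI yI (ltW xy)).
have -> : F x = 0 by rewrite /F set_itv1 Rintegral_set1.
rewrite sub0r => h.
have -> : (\int[lebesgue_measure]_(t in `[x, y]) (phi t)%:E)%E = (F y)%:E.
  by rewrite /F /Rintegral fineK//; exact: integrable_fin_num.
change ((k y - k x)%:E <= (F y)%:E)%E; rewrite lee_fin.
by move: (k x) (k y) (F y) h => p q r; lra.
Qed.

End Bounds.

(** * The speed bound *)

Section SpeedBound.
Context {R : realType} {n : nat} {M : topologicalType}.
Variable Q : riemannian R n M.
Implicit Types (c : R -> M) (t x y : R).

Lemma lee_telescope (p q r : R) : ((p - r)%:E <= (q - r)%:E + (p - q)%:E)%E.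
Proof. by rewrite -EFinD lee_fin; lra. Qed.

(** Lower bounds on the pieces add up through additivity of the integral on a disjoint union, so
    measurability is carried along in the induction. The bounds themselves telescope because
    adjacent pieces share the speed at their junction. *)
Lemma speed_growth a b c (C l : R) t : a < b -> C1_curve Q a b c ->
  piecewise_smooth Q a b c -> 0 < C -> 0 < l -> a <= t <= b ->
  measurable_fun `[a, t]%classic (fun s => accel_norm Q a b c s ^+ 2) /\
  ((Num.sqrt (speed Q a b c t ^+ 2 + C) - Num.sqrt (speed Q a b c a ^+ 2 + C))%:E <=
   \int[lebesgue_measure]_(s in `[a, t])
      (l / 2 * accel_norm Q a b c s ^+ 2 + (2 * l)^-1)%:E)%E.
Proof.
move=> ab c1 pw C0 l0 /andP[at0 tb].
have pwt : piecewise_smooth Q a t c by exact: piecewise_smooth_sub pw _ at0 tb.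
apply: (piecewise_smooth_ind pwt (P := fun t =>
  measurable_fun `[a, t]%classic (fun s => accel_norm Q a b c s ^+ 2) /\
  ((Num.sqrt (speed Q a b c t ^+ 2 + C) - Num.sqrt (speed Q a b c a ^+ 2 + C))%:E <=
   \int[lebesgue_measure]_(s in `[a, t])
      (l / 2 * accel_norm Q a b c s ^+ 2 + (2 * l)^-1)%:E)%E)).
  split; first by rewrite set_itv1; exact: measurable_fun_set1.
  by rewrite set_itv1 integral_set1 subrr.
move=> x y ax xy yt sc [mx IH].
have [e [c' [e0 cc' sp acc]]] := smooth_piece ax xy (le_trans yt tb) c1 sc.
pose phi s := l / 2 * accel_norm Q a b c s ^+ 2 + (2 * l)^-1.
pose psi s := l / 2 * sqaccel Q c' s + (2 * l)^-1.
have inI s : x <= s <= y -> `]x - e, y + e[%classic s.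
  by rewrite /= in_itv/= => /andP[? ?]; apply/andP; split; lra.
have phi0 s : 0 <= phi s.
  apply: addr_ge0; last by rewrite invr_ge0 mulr_ge0// ltW.
  by apply: mulr_ge0; [rewrite divr_ge0// ltW|exact: sqr_ge0].
have msq : measurable_fun `]x, y[%classic (sqaccel Q c' : R -> R).
  apply: open_continuous_measurable_fun; first exact: interval_open.
  move=> s; rewrite inE/= in_itv/= => /andP[xs sy].
  apply: (sqaccel_continuous (interval_open _ _) cc') => //.
  by apply: inI; rewrite !ltW.
have moo : measurable_fun `]x, y[%classic (fun s => accel_norm Q a b c s ^+ 2).
  apply: eq_measurable_fun msq => s; rewrite inE/= in_itv/= => xsy.
  by have [_ ->] := acc s xsy.
have moc : measurable_fun `]x, y]%classic (fun s => accel_norm Q a b c s ^+ 2).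
  exact: (measurable_fun_itv_bndo_bndcP _ _ _).1 moo.
have E : `[a, y]%classic = `[a, x]%classic `|` `]x, y]%classic.
  by rewrite -itv_bndbnd_setU// bnd_simp// ltW.
have my : measurable_fun `[a, y]%classic (fun s => accel_norm Q a b c s ^+ 2).
  by rewrite E; apply/measurable_funU.
split; first exact: my.
have mphi : measurable_fun `[a, y]%classic (EFin \o phi).
  apply/measurable_EFinP; apply: measurable_funD; last exact: measurable_cst.
  by apply: measurable_funM => //; exact: measurable_cst.
have mphioo : measurable_fun `]x, y[%classic (EFin \o phi).
  apply: measurable_funS mphi => //.
  by move=> s; rewrite /= !in_itv/= => /andP[/ltW xs /ltW ->]; rewrite (le_trans ax xs).
have mpsi : measurable_fun `]x, y[%classic (EFin \o psi).
  apply/measurable_EFinP; apply: measurable_funD; last exact: measurable_cst.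
  by apply: measurable_funM => //; exact: measurable_cst.
have disj : [disjoint `[a, x]%classic & `]x, y]%classic].
  rewrite disj_set2E; apply/eqP/seteqP; split => // s [] /=.
  by rewrite !in_itv/= => /andP[_ sx] /andP[+ _]; rewrite ltNge sx.
have mphiU : measurable_fun (`[a, x]%classic `|` `]x, y]%classic) (EFin \o phi).
  by rewrite -E.
have := @ge0_integral_setU _ _ _ lebesgue_measure `[a, x]%classic `]x, y]%classic
  (measurable_itv _) (measurable_itv _) (EFin \o phi) mphiU (fun s _ => phi0 s) disj.
rewrite -E => ->.
(* Both integrals reduce to the open interval, where the curve and its extension have the same
   acceleration; at the end points they may differ. *)
have -> : (\int[lebesgue_measure]_(s in `]x, y]) (phi s)%:E =
           \int[lebesgue_measure]_(s in `[x, y]) (psi s)%:E)%E.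
  apply: (etrans (integral_itv_bndoo false false mphioo)).
  apply: etrans (esym (integral_itv_bndoo true false mpsi)).
  apply: eq_integral => s; rewrite inE/= in_itv/= => xsy.
  by rewrite /phi /psi; have [_ ->] := acc s xsy.
have oI : open `]x - e, y + e[%classic by exact: interval_open.
have h := smooth_speed_growth oI cc' xy inI C0 l0.
apply: le_trans (leeD IH h).
rewrite -(sp y) ?lexx ?(ltW xy)// -(sp x) ?lexx ?(ltW xy)//.
exact: lee_telescope.
Qed.

Lemma speed_le T c (C : R) t : 0 < T -> 0 < C -> C1_curve Q 0 T c ->
  piecewise_smooth Q 0 T c ->
  (\int[lebesgue_measure]_(s in `[0%R, T]) (accel_norm Q 0 T c s ^+ 2)%:E <= C%:E)%E ->
  0 <= t <= T ->
  speed Q 0 T c t <= Num.sqrt (C * T) + Num.sqrt (C * T + speed Q 0 T c 0 ^+ 2).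
Proof.
move=> T0 C0 c1 pw HC tT.
have CT0 : 0 < C * T by rewrite mulr_gt0.
(* This value minimizes [l / 2 * C + (2 * l)^-1 * T], and the minimum is [Num.sqrt (C * T)]. *)
pose l := Num.sqrt T / Num.sqrt C.
have sT : 0 < Num.sqrt T by rewrite sqrtr_gt0.
have sC : 0 < Num.sqrt C by rewrite sqrtr_gt0.
have l0 : 0 < l by rewrite divr_gt0.
have [_ ht] := speed_growth T0 c1 pw CT0 l0 tT.
have [|mT _] := speed_growth (t := T) T0 c1 pw CT0 l0.
  by rewrite lexx ltW.
have l2 : 0 <= l / 2 by rewrite divr_ge0// ltW.
have l2' : 0 <= (2 * l)^-1 by rewrite invr_ge0 mulr_ge0// ltW.
have sq0 s : 0 <= l / 2 * accel_norm Q 0 T c s ^+ 2.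
  by apply: mulr_ge0 => //; exact: sqr_ge0.
have hT : (\int[lebesgue_measure]_(s in `[0%R, t])
      (l / 2 * accel_norm Q 0 T c s ^+ 2 + (2 * l)^-1)%:E <=
    \int[lebesgue_measure]_(s in `[0%R, T])
      (l / 2 * accel_norm Q 0 T c s ^+ 2 + (2 * l)^-1)%:E)%E.
  apply: ge0_subset_le_integral => [s _|s _|s]; rewrite ?lee_fin ?addr_ge0//.
  rewrite /= !in_itv/= => /andP[-> st]; split => //.
  by case/andP: tT => _; exact: le_trans.
have eT : (\int[lebesgue_measure]_(s in `[0%R, T])
      (l / 2 * accel_norm Q 0 T c s ^+ 2 + (2 * l)^-1)%:E <=
      (l / 2 * C + (2 * l)^-1 * T)%:E)%E.
  under eq_integral do rewrite EFinD.
  rewrite ge0_integralD//=; last 2 first.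
  - by move=> s _; rewrite lee_fin.
  - by apply/measurable_EFinP; apply: measurable_funM => //; exact: measurable_cst.
  rewrite integral_itv_cst ?(ltW T0)// subr0 EFinD; apply: leeD => //.
  under eq_integral do rewrite EFinM.
  rewrite ge0_integralZl_EFin//; last 2 first.
  - by move=> s _; rewrite lee_fin sqr_ge0.
  - exact/measurable_EFinP.
  by rewrite [leRHS]EFinM; apply: lee_wpmul2l => //; rewrite lee_fin.
have := le_trans ht (le_trans hT eT); rewrite lee_fin.
have -> : l / 2 * C + (2 * l)^-1 * T = Num.sqrt (C * T).
  rewrite sqrtrM ?(ltW C0)// /l.
  move: sT sC (sqr_sqrtr (ltW T0)) (sqr_sqrtr (ltW C0)).
  move: (Num.sqrt T) (Num.sqrt C) => w u w0 u0 <- <-.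
  by field; rewrite !gt_eqF.
have vk : speed Q 0 T c t <= Num.sqrt (speed Q 0 T c t ^+ 2 + C * T).
  rewrite -[leLHS]ger0_norm ?gnorm_ge0// -sqrtr_sqr ler_wsqrtr// lerDl.
  exact: ltW.
by move=> h; apply: (le_trans vk); rewrite -lerBlDr [C * T + _]addrC.
Qed.

End SpeedBound.

(** * The action *)

Section Lipschitz.
Context {R : realType} {n : nat} {M : topologicalType}.
Variable Q : riemannian R n M.
Variables (a b : R) (c : R -> M) (v : R).
Hypotheses (ab : a < b) (c1 : C1_curve Q a b c) (pw : piecewise_smooth Q a b c).
Hypotheses (v0 : 0 <= v) (sv : forall t, a <= t <= b -> speed Q a b c t <= v).

(* The restriction of [c], traversed backwards if [t2 < t1]. *)
Lemma subpath t1 t2 : a <= t1 <= b -> a <= t2 <= b -> t1 != t2 ->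
  exists x y w, [/\ x < y, piecewise_smooth Q x y w, w x = c t1 /\ w y = c t2,
    y - x = `|t2 - t1| & forall t, x < t < y -> speed Q x y w t <= v].
Proof.
move=> /andP[a1 b1] /andP[a2 b2]; rewrite neq_lt => /orP[t12|t21].
  exists t1, t2, c; split => //.
  - by apply: piecewise_smooth_sub pw _ _ _ => //; exact: ltW.
  - by rewrite gtr0_norm// subr_gt0.
  - move=> t /andP[h1 h2]; rewrite (speed_sub ab c1 a1 b2 t12) ?(ltW h1) ?(ltW h2)//.
    by apply: sv; rewrite (le_trans a1 (ltW h1)) (le_trans (ltW h2) b2).
have pw' : piecewise_smooth Q t2 t1 c.
  by apply: piecewise_smooth_sub pw _ _ _ => //; exact: ltW.
pose h := t1 + t2.
have hE1 : h - t1 = t2 by rewrite /h; ring.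
have hE2 : h - t2 = t1 by rewrite /h; ring.
exists t2, t1, (c \o affine (-1) h); split => //.
- by have := piecewise_smooth_flip h pw'; rewrite hE1 hE2.
- by split; rewrite /= /affine; congr c; rewrite /h; ring.
- by rewrite ltr0_norm ?subr_lt0// opprB.
- move=> t /andP[h1 h2].
  have tt : t2 < h - t < t1 by apply/andP; split; rewrite /h; lra.
  rewrite -{1}hE1 -{2}hE2 (speed_flip ab c1 a2 b1 tt).
  have tt' : t2 <= h - t <= t1 by case/andP: tt => /ltW -> /ltW ->.
  rewrite (speed_sub ab c1 a2 b1 t21 tt').
  by apply: sv; case/andP: tt' => h3 h4; rewrite (le_trans a2 h3) (le_trans h4 b1).
Qed.

Lemma dist_lipschitz_r p t1 t2 : a <= t1 <= b -> a <= t2 <= b ->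
  (dist Q p (c t2) <= dist Q p (c t1) + (v * `|t2 - t1|)%:E)%E.
Proof.
move=> h1 h2; have [<-|ne] := eqVneq t1 t2.
  by rewrite subrr normr0 mulr0 adde0.
have [x [y [w [xy pxy [wx wy] <- spw]]]] := subpath h1 h2 ne.
by rewrite -wx -wy; exact: dist_append.
Qed.

Lemma dist_lipschitz_l p t1 t2 : a <= t1 <= b -> a <= t2 <= b ->
  (dist Q (c t2) p <= dist Q (c t1) p + (v * `|t2 - t1|)%:E)%E.
Proof.
move=> h1 h2; have [<-|ne] := eqVneq t2 t1.
  by rewrite subrr normr0 mulr0 adde0.
have [x [y [w [xy pxy [wx wy] e spw]]]] := subpath h2 h1 ne.
by rewrite distrC -e -wx -wy; exact: dist_prepend.
Qed.

End Lipschitz.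

Section Action.
Context {R : realType} {n : nat} {M : topologicalType}.
Variables (Q : riemannian R n M) (s : nat) (T : R) (T0 : 0 < T).
Variables (E : rel 'I_s) (V : 'I_s -> 'I_s -> M * M -> R).
Implicit Types (q w : 'I_s -> R -> M) (i j : 'I_s).
Hypothesis V_ge0 : forall i j, E i j -> forall z, 0 <= V i j z.

Definition lagrangian (q : 'I_s -> R -> M) (i : 'I_s) (t : R) : R :=
  accel_norm Q 0 T (q i) t ^+ 2 +
  2^-1 * \sum_(j in neighbors E i) V i j (q i t, q j t).

Definition agent_action q i : \bar R :=
  (\int[lebesgue_measure]_(t in `[0%R, T]) (lagrangian q i t)%:E)%E.

Lemma potential_ge0 q i t : 0 <= \sum_(j in neighbors E i) V i j (q i t, q j t).
Proof. by apply: sumr_ge0 => j; rewrite inE => Eij; exact: V_ge0. Qed.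

Lemma lagrangian_ge0 q i t : 0 <= lagrangian q i t.
Proof.
by rewrite addr_ge0 ?sqr_ge0// mulr_ge0 ?invr_ge0// potential_ge0.
Qed.

Lemma agent_action_ge0 q i : (0 <= agent_action q i)%E.
Proof. by apply: integral_ge0 => t _; rewrite lee_fin; exact: lagrangian_ge0. Qed.

(** The common factor [2^-1] cancels: a bound c/2 on the action is a bound c on the sum over the
    agents, the form used from here on. *)
Lemma action_le q w C : (action Q T E V q <= action Q T E V w)%E ->
  (\sum_(i < s) agent_action w i <= C)%E -> (\sum_(i < s) agent_action q i <= C)%E.
Proof.
rewrite /action lee_pmul2l// => h; exact: le_trans h.
Qed.

Lemma agent_action_le_sum q i : (agent_action q i <= \sum_(i < s) agent_action q i)%E.
Proof.
rewrite (bigD1 i)//=; apply: leeDl; apply: sume_ge0 => k _; exact: agent_action_ge0.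
Qed.

Lemma agent_action2_le_sum q i j : j != i ->
  (agent_action q i + agent_action q j <= \sum_(i < s) agent_action q i)%E.
Proof.
move=> ji; rewrite (bigD1 i)//= (bigD1 j)//= (addeA (agent_action q i) (agent_action q j)).
apply: leeDl; apply: sume_ge0 => k _.
exact: agent_action_ge0.
Qed.

Lemma accel_integral_le q i :
  (\int[lebesgue_measure]_(t in `[0%R, T]) (accel_norm Q 0 T (q i) t ^+ 2)%:E <=
   agent_action q i)%E.
Proof.
apply: ge0_subset_le_integral => [t _|t _|t tT]; rewrite ?lee_fin.
- exact: sqr_ge0.
- exact: lagrangian_ge0.
- by split => //; rewrite lerDl mulr_ge0 ?invr_ge0// potential_ge0.
Qed.

Lemma agent_action_ge q i j x y K : E i j -> 0 <= x -> x <= y -> y <= T -> 0 <= K ->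
  (forall t, x <= t <= y -> K <= V i j (q i t, q j t)) ->
  ((2^-1 * K * (y - x))%:E <= agent_action q i)%E.
Proof.
move=> Eij x0 xy yT K0 H; rewrite -integral_itv_cst//.
apply: ge0_subset_le_integral => [t _|t _|t]; rewrite ?lee_fin.
- by rewrite mulr_ge0 ?invr_ge0.
- exact: lagrangian_ge0.
rewrite /= !in_itv/= => /andP[xt ty]; split.
  by rewrite (le_trans x0 xt) (le_trans ty yT).
apply: (@le_trans _ _ (2^-1 * V i j (q i t, q j t))).
  by rewrite ler_wpM2l ?invr_ge0// H// xt.
rewrite /lagrangian (bigD1 j) ?inE//= mulrDr addrCA lerDl.
rewrite addr_ge0 ?sqr_ge0// mulr_ge0 ?invr_ge0// sumr_ge0// => k /andP[].
by rewrite inE => Eik _; exact: V_ge0.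
Qed.

Lemma agent_action_le q i (Vm : 'I_s -> R) :
  C1_curve Q 0 T (q i) -> piecewise_smooth Q 0 T (q i) ->
  (forall j, E i j -> 0 <= Vm j) ->
  (forall j, E i j -> forall t, 0 <= t <= T -> V i j (q i t, q j t) <= Vm j) ->
  (agent_action q i <=
   ((max_accel Q T (q i) ^+ 2 + \sum_(j in neighbors E i) Vm j) * T)%:E)%E.
Proof.
move=> c1 pw Vm0 VVm; rewrite -[X in _ * X]subr0.
have S0 : 0 <= \sum_(j in neighbors E i) Vm j.
  by apply: sumr_ge0 => j; rewrite inE; exact: Vm0.
apply: (piecewise_integral_le pw) => [t _||x y x0 xy yT sc t xty].
- exact: lagrangian_ge0.
- by rewrite addr_ge0 ?sqr_ge0.
have tT : 0 <= t <= T.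
  by case/andP: xty => xt ty; rewrite (le_trans x0 (ltW xt)) (le_trans (ltW ty) yT).
(* [max_accel] sees only the times where the acceleration exists, which include the interior of
   every piece. *)
have [e [c' [_ _ _ /(_ t xty)[ha _]]]] := smooth_piece x0 xy yT c1 sc.
have am := accel_norm_le_max_accel T0 c1 pw tT ha.
rewrite lerD//.
  by rewrite lerXn2r ?nnegrE ?gnorm_ge0// (le_trans _ am)// gnorm_ge0.
(* The weight [2^-1] of the potential is bounded by 1, since [cost_bound] sums [Vm] without it. *)
apply: (@le_trans _ _ (1 * \sum_(j in neighbors E i) Vm j)); last by rewrite mul1r.
rewrite ler_pM ?invr_ge0 ?potential_ge0// ?invf_le1 ?ler1n//.
by apply: ler_sum => j; rewrite inE => Eij; exact: VVm.
Qed.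

End Action.

(** * Collision avoidance *)

Theorem proposition2 (R : realType) (n : nat) (M : topologicalType)
  (Q : riemannian R n M)
  (Qconn : connected [set: M]) (Qcompl : complete_mfd Q)
  (s : nat) (hs : (2 <= s)%N) (T : R) (hT : 0 < T)
  (E : rel 'I_s) (Esym : symmetric E) (Eirr : irreflexive E)
  (q0 qT : 'I_s -> M)
  (v0 : forall i, tangent Q (q0 i)) (vT : forall i, tangent Q (qT i))
  (r rs Rs Vm Vs : 'I_s -> 'I_s -> R)
  (hr : forall i j, E i j -> [/\ 0 < r i j, r i j < rs i j & rs i j < Rs i j])
  (hVmVs : forall i j, E i j -> 0 < Vm i j /\ Vm i j < Vs i j)
  (hrsym : forall i j, E i j ->
     [/\ r i j = r j i, rs i j = rs j i & Rs i j = Rs j i])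
  (V : 'I_s -> 'I_s -> M * M -> R)
  (VC1 : forall i j, E i j -> C1_on_square Q (V i j))
  (V_ge0 : forall i j, E i j -> forall z, 0 <= V i j z)
  (V_sym : forall i j, E i j -> forall z, V i j z = V j i z)
  (V_swap : forall i j, E i j -> forall x y, V i j (x, y) = V i j (y, x))
  (V_risk : forall i j, E i j ->
     forall z, nearer Q (rs i j) z -> Vs i j < V i j z)
  (V_safe : forall i j, E i j ->
     forall z, farther Q (Rs i j) z -> V i j z < Vm i j)
  (q : 'I_s -> R -> M) (hq : admissible T v0 vT q)
  (q_safe : forall i j, E i j -> forall t, 0 <= t <= T ->
     farther Q (Rs i j) (q i t, q j t)) :
  let c := cost_bound Q T E Vm q in
  let v i := speed_bound T c (v0 i) in
  (forall i j, E i j ->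
     c * (v i + v j) / (2 * (rs i j - r i j)) < Vs i j) ->
  forall qs : 'I_s -> R -> M,
    minimizer (admissible T v0 vT) (action Q T E V) qs ->
    forall i j, E i j -> forall t, 0 <= t <= T ->
      ~ nearer Q (r i j) (qs i t, qs j t).
Proof.
move=> c v Hc qs [Aqs Jmin] i j Eij t tT; rewrite /nearer /= => near_t.
have Vm_gt0 k l : E k l -> 0 < Vm k l by move=> /hVmVs[].
have neq_ji : j != i by apply: contraTneq Eij => ->; rewrite Eirr.
have Vpot0 k : 0 <= \sum_(l in neighbors E k) Vm k l.
  by apply: sumr_ge0 => l; rewrite inE => /Vm_gt0/ltW.
(* The edge [(i, j)] alone makes [c] positive, through [Vm i j]; the speed bound divides by the
   square root of [c]. *)
have c_gt0 : 0 < c.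
  rewrite /c /cost_bound mulr_gt0// (bigD1 i)//= ltr_wpDr//.
    by apply: sumr_ge0 => k _; rewrite addr_ge0 ?sqr_ge0.
  rewrite ltr_wpDl ?sqr_ge0// (bigD1 j) ?inE//= ltr_wpDr ?Vm_gt0//.
  by apply: sumr_ge0 => k /andP[]; rewrite inE => /Vm_gt0/ltW.
have Sq : (\sum_(k < s) agent_action Q T E V q k <= c%:E)%E.
  apply: (@le_trans _ _ (\sum_(k < s)
     ((max_accel Q T (q k) ^+ 2 + \sum_(l in neighbors E k) Vm k l) * T)%:E)%E).
    apply: lee_sum => k _; have [c1 pw _ _ _] := hq k.
    apply: agent_action_le => // l Ekl; first exact: ltW (Vm_gt0 _ _ Ekl).
    move=> u uT; apply: ltW; apply: V_safe => //; exact: q_safe.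
  by rewrite sumEFin -mulr_suml mulrC.
have Sqs : (\sum_(k < s) agent_action Q T E V qs k <= c%:E)%E.
  exact: action_le (Jmin q hq) Sq.
have T00 : 0 <= (0 : R) <= T by rewrite lexx ltW.
have TTT : 0 <= T <= T by rewrite lexx ltW.
have v_ge0 k : 0 <= v k by rewrite addr_ge0 ?sqrtr_ge0.
have v_gt0 k : 0 < v k by rewrite ltr_wpDr ?sqrtr_ge0// sqrtr_gt0 mulr_gt0.
have speed_le_v k u : 0 <= u <= T -> speed Q 0 T (qs k) u <= v k.
  move=> uT; have [c1 pw e0 _ vel] := Aqs k.
  have acc : (\int[lebesgue_measure]_(u in `[0%R, T])
      (accel_norm Q 0 T (qs k) u ^+ 2)%:E <= c%:E)%E.
    apply: (@le_trans _ _ (agent_action Q T E V qs k)).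
      exact: accel_integral_le.
    by apply: le_trans Sqs; exact: agent_action_le_sum.
  have := speed_le hT c_gt0 c1 pw acc uT.
  rewrite /v /speed_bound [speed Q 0 T (qs k) 0]/speed /gnorm e0 /=.
  by have [-> //] := vel _ (chart_at_atlas Q (q0 k)); exact: chart_at_dom.
have lip_i := dist_lipschitz_l hT _ _ (v_ge0 i) (speed_le_v i).
have lip_j := dist_lipschitz_r hT _ _ (v_ge0 j) (speed_le_v j).
have [c1i pwi e0i eTi _] := Aqs i; have [c1j pwj e0j eTj _] := Aqs j.
have [r0 rrs rsRs] := hr i j Eij.
have vv : 0 < v i + v j by rewrite addr_gt0.
pose d := (rs i j - r i j) / (v i + v j).
have d0 : 0 < d by rewrite divr_gt0// subr_gt0.
(* Moving [i] and then [j] changes the distance by at most [(v i + v j) * d], which is the gap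
   between the two radii. The inequality is strict because [near_t] is, so the whole closed time
   interval is covered. *)
have close u : 0 <= u <= T -> `|u - t| <= d -> nearer Q (rs i j) (qs i u, qs j u).
  move=> uT ud; rewrite /nearer /=.
  apply: le_lt_trans (lip_i c1i pwi (qs j u) t u tT uT) _.
  apply: (@le_lt_trans _ _ (dist Q (qs i t) (qs j t) + (v j * `|u - t|)%:E +
     (v i * `|u - t|)%:E)%E).
    by apply: leeD => //; exact: lip_j.
  apply: (@lt_le_trans _ _ ((r i j)%:E + (v j * `|u - t|)%:E + (v i * `|u - t|)%:E)%E).
    by rewrite !lteD2rE.
  rewrite -!EFinD lee_fin -addrA -mulrDl [v j + _]addrC -lerBrDl.
  by rewrite mulrC -ler_pdivlMr.
(* The minimizer and the reference trajectory have the same boundary values, so safety of the latter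
   applies to the former at both ends. *)
have far u : u = 0 \/ u = T -> ~ nearer Q (rs i j) (qs i u, qs j u).
  move=> uE; have [-> ->] : qs i u = q i u /\ qs j u = q j u.
    have [_ _ f0i fTi _] := hq i; have [_ _ f0j fTj _] := hq j.
    by case: uE => ->; split; congruence.
  have uT : 0 <= u <= T by case: uE => ->.
  rewrite /nearer /= => lt; have := q_safe i j Eij u uT; rewrite /farther /=.
  by move=> /lt_trans /(_ lt); rewrite lte_fin ltNge (ltW rsRs).
case/andP: (tT) => t0 tT'.
have td0 : 0 <= t - d.
  rewrite leNgt; apply/negP => h; apply: (far 0); first by left.
  apply: close => //; rewrite sub0r normrN ger0_norm//; lra.
have tdT : t + d <= T.
  rewrite leNgt; apply/negP => h; apply: (far T); first by right.
  apply: close => //; rewrite ger0_norm; lra.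
have Vs0 : 0 <= Vs i j by have [h1 h2] := hVmVs i j Eij; rewrite ltW// (lt_trans h1).
have Vlow u : t - d <= u <= t + d -> Vs i j <= V i j (qs i u, qs j u).
  move=> /andP[h1 h2]; apply: ltW; apply: V_risk => //; apply: close.
    by apply/andP; split; lra.
  by rewrite ler_norml; apply/andP; split; lra.
have Eji : E j i by rewrite Esym.
have tdd : t - d <= t + d by lra.
have Ai : ((2^-1 * Vs i j * (t + d - (t - d)))%:E <= agent_action Q T E V qs i)%E.
  exact: agent_action_ge td0 tdd tdT Vs0 Vlow.
(* The pair is counted twice, once for each agent. Each share is [2^-1 * Vs i j] over a time
   [2 * d], so the total is [2 * d * Vs i j]; this is the origin of the factor 2 in the denominator
   of the hypothesis [Hc]. *)
have Vlow' u : t - d <= u <= t + d -> Vs i j <= V j i (qs j u, qs i u).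
  by move=> h; rewrite -V_sym// V_swap//; exact: Vlow.
have Aj : ((2^-1 * Vs i j * (t + d - (t - d)))%:E <= agent_action Q T E V qs j)%E.
  exact: agent_action_ge td0 tdd tdT Vs0 Vlow'.
have Aij : (agent_action Q T E V qs i + agent_action Q T E V qs j <= c%:E)%E.
  by apply: le_trans Sqs; exact: agent_action2_le_sum.
have := le_trans (leeD Ai Aj) Aij.
rewrite -EFinD lee_fin => hle.
have := Hc i j Eij; rewrite ltr_pdivrMr; last by rewrite mulr_gt0// subr_gt0.
have dE : d * (v i + v j) = rs i j - r i j by rewrite /d divfK// gt_eqF.
clearbody d; rewrite -dE; apply/negP; rewrite -leNgt.
rewrite !mulrA ler_pM2r//; apply: le_trans hle; rewrite le_eqVlt; apply/orP; left; apply/eqP.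
by field.
Qed.
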